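(* For $k\ge 1$ let $h_k(\mathbf u)=\sum_{i_1<i_2<\cdots<i_k} u_{i_k}\cdots u_{i_2}u_{i_1}$ (sum over strictly increasing sequences of integers). The operators $h_k(\mathbf u)$, $k\ge1$, pairwise commute, and the $K$-subalgebra of $\mathrm{End}_K(\mathbf F)$ they generate is isomorphic to the algebra of symmetric functions over $K$; more precisely, the $h_k(\mathbf u)$ are algebraically independent, so that $h_k\mapsto h_k(\mathbf u)$ (with $h_k$ the complete homogeneous symmetric functions) extends to an injective $K$-algebra homomorphism from the ring of symmetric functions over $K$ into $\mathrm{End}_K(\mathbf F)$.
   Context: Fix an integer $n\ge 1$. Partitions are drawn in English notation; the box in row $r$ and column $c$ lies on diagonal $c-r$. An $n$-ribbon is a connected skew shape with $n$ boxes containing no $2\times 2$ square; its head is its top-right box, and its spin is its number of rows minus $1$. Let $K=\mathbb{C}(q)$ and let $\mathbf F$ be the $K$-vector space with basis the set of all partitions. For $i\in\mathbb{Z}$ the operator $u_i\in\mathrm{End}_K(\mathbf F)$ is defined by $u_i(\lambda)=q^{\mathrm{spin}(\mu/\lambda)}\mu$ if there is a partition $\mu\supseteq\lambda$ with $\mu/\lambda$ an $n$-ribbon whose head lies on diagonal $i$, and $u_i(\lambda)=0$ otherwise. On any given partition only finitely many terms of $h_k(\mathbf u)$ act nontrivially, so $h_k(\mathbf u)$ is a well-defined operator on $\mathbf F$. *)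

(* Defs.v *)
From HB Require Import structures.
From mathcomp Require Import all_boot all_order all_algebra.
From mathcomp Require Import finmap freeg mpoly complex.
From mathcomp Require Import boolp classical_sets functions cardinality fsbigop.
From mathcomp Require Import reals zify.

Set Implicit Arguments.
Unset Strict Implicit.
Unset Printing Implicit Defensive.

Import Order.TTheory GRing.Theory Num.Theory.

Local Open Scope ring_scope.

(* Weakly decreasing sequences of positive integers. *)
Record intpart := IntPart {
  parts :> seq nat;
  _ : sorted geq parts && (0%N \notin parts)
}.

HB.instance Definition _ := [isSub for parts].
HB.instance Definition _ := [Countable of intpart by <:].

(* English notation: (r, c) is the box in row r and column c, numbered from 0
   (the diagonal c - r does not depend on the origin). *)
Definition box : Type := (nat * nat)%type.

Definition diagram (la : intpart) : {fset box} :=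
  [fset b in [seq (r, c) | r <- iota 0 (size la), c <- iota 0 (nth 0%N la r)]]%fset.

Definition diagonal (b : box) : int := b.2%:Z - b.1%:Z.

Definition adjacent (a b : box) : bool :=
  (a.1 == b.1) && ((a.2 == b.2.+1) || (b.2 == a.2.+1))
  || (a.2 == b.2) && ((a.1 == b.1.+1) || (b.1 == a.1.+1)).

Definition connected_shape (D : {fset box}) : bool :=
  [forall x : D, forall y : D,
     connect (fun a b : D => adjacent (val a) (val b)) x y].

Definition has_square (D : {fset box}) : bool :=
  [exists x : D, [&& ((val x).1, (val x).2.+1) \in D,
                     ((val x).1.+1, (val x).2) \in D &
                     ((val x).1.+1, (val x).2.+1) \in D]].

Definition is_ribbon (n : nat) (D : {fset box}) : bool :=
  [&& #|` D|%fset == n, connected_shape D & ~~ has_square D].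

(* The top-right box: in the topmost row and in the rightmost column. *)
Definition is_head (D : {fset box}) (b : box) : bool :=
  (b \in D) &&
  [forall x : D, (b.1 <= (val x).1)%N && ((val x).2 <= b.2)%N].

Definition spin (D : {fset box}) : nat :=
  (#|` [fset b.1 | b : box in D]|%fset).-1.

Definition skew (mu la : intpart) : {fset box} :=
  (diagram mu `\` diagram la)%fset.

Definition adds_ribbon (n : nat) (i : int) (la mu : intpart) : bool :=
  [&& (diagram la `<=` diagram mu)%fset,
      is_ribbon n (skew mu la) &
      [exists b : skew mu la, is_head (skew mu la) (val b)
                              && (diagonal (val b) == i)]].

Notation fock K := {freeg intpart / K}.

Section LinearExtension.
Variables (K : fieldType) (T : choiceType) (M : lmodType K) (f : T -> M).

Definition lin_ext (D : {freeg T / K}) : M := fglift f D.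

Lemma lin_ext_is_zmod_morphism : zmod_morphism lin_ext.
Proof. exact: lift_is_additive. Qed.

HB.instance Definition _ :=
  GRing.isZmodMorphism.Build {freeg T / K} M lin_ext lin_ext_is_zmod_morphism.

Lemma lin_ext_is_scalable : scalable lin_ext.
Proof.
move=> a D; have -> : a *: D = \sum_(x <- dom D) << a * coeff x D *g x >> by [].
rewrite -[in RHS](freeg_sumE D) [in LHS]raddf_sum [in RHS]raddf_sum.
rewrite raddf_sum; apply: eq_bigr => x _ /=.
by rewrite /lin_ext !liftU scalerA.
Qed.

HB.instance Definition _ :=
  GRing.isScalable.Build K {freeg T / K} M *:%R lin_ext lin_ext_is_scalable.

Lemma lin_extU x : lin_ext << x >> = f x.
Proof. by rewrite /lin_ext liftU scale1r. Qed.

End LinearExtension.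

(* A ring under composition: (f * g) v = f (g v). *)
Definition fock_end (K : fieldType) : Type := {linear fock K -> fock K}.

Section FockEnd.
Variable K : fieldType.
Implicit Types f g h : fock_end K.

HB.instance Definition _ := gen_eqMixin (fock_end K).
HB.instance Definition _ := gen_choiceMixin (fock_end K).

Lemma fock_endP f g : (forall v, f v = g v) <-> f = g.
Proof.
split=> [fg|-> //]; have {fg} : f = g :> (fock K -> fock K) by apply/funext.
case: f => f [[f0] [f1]]; case: g => g [[g0] [g1]] /= fg.
move: f0 f1 g0 g1; rewrite {}fg => f0 f1 g0 g1.
by rewrite (Prop_irrelevance f0 g0) (Prop_irrelevance f1 g1).
Qed.

Definition end_zero : fock_end K := \0 : {linear _ -> _}.
Definition end_opp f : fock_end K := \- f : {linear _ -> _}.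
Definition end_add f g : fock_end K := (f \+ g) : {linear _ -> _}.
Definition end_scale (a : K) f : fock_end K := (a \*: f) : {linear _ -> _}.
Definition end_one : fock_end K := idfun : {linear _ -> _}.
Definition end_mul f g : fock_end K := (f \o g) : {linear _ -> _}.

Lemma end_addA : associative end_add.
Proof. by move=> f g h; apply/fock_endP => v; apply: addrA. Qed.
Lemma end_addC : commutative end_add.
Proof. by move=> f g; apply/fock_endP => v; apply: addrC. Qed.
Lemma end_add0 : left_id end_zero end_add.
Proof. by move=> f; apply/fock_endP => v; apply: add0r. Qed.
Lemma end_addN : left_inverse end_zero end_opp end_add.
Proof. by move=> f; apply/fock_endP => v; apply: addNr. Qed.

HB.instance Definition _ :=
  GRing.isZmodule.Build (fock_end K) end_addA end_addC end_add0 end_addN.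

Lemma end_mulA : associative end_mul.
Proof. by move=> f g h; apply/fock_endP. Qed.
Lemma end_mul1l : left_id end_one end_mul.
Proof. by move=> f; apply/fock_endP. Qed.
Lemma end_mul1r : right_id end_one end_mul.
Proof. by move=> f; apply/fock_endP. Qed.
Lemma end_mulDl : left_distributive end_mul +%R.
Proof. by move=> f g h; apply/fock_endP. Qed.
Lemma end_mulDr : right_distributive end_mul +%R.
Proof. by move=> f g h; apply/fock_endP => v; apply: (linearD f). Qed.
Lemma end_oner_neq0 : end_one != 0.
Proof.
apply/eqP => /fock_endP /(_ << IntPart (isT : sorted geq [::] && _) >>) /=.
move=> /(congr1 (coeff (IntPart (isT : sorted geq [::] && _)))).
by rewrite coeffU coeff0 eqxx mulr1 => /eqP; rewrite oner_eq0.
Qed.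

HB.instance Definition _ :=
  GRing.Zmodule_isNzRing.Build (fock_end K) end_mulA end_mul1l end_mul1r
    end_mulDl end_mulDr end_oner_neq0.

Lemma end_scaleA a b f : end_scale a (end_scale b f) = end_scale (a * b) f.
Proof. by apply/fock_endP => v; apply: scalerA. Qed.
Lemma end_scale1 : left_id 1 end_scale.
Proof. by move=> f; apply/fock_endP => v; apply: scale1r. Qed.
Lemma end_scaleDr : right_distributive end_scale +%R.
Proof. by move=> a f g; apply/fock_endP => v; apply: scalerDr. Qed.
Lemma end_scaleDl f : {morph end_scale^~ f : a b / a + b}.
Proof. by move=> a b; apply/fock_endP => v; apply: scalerDl. Qed.

HB.instance Definition _ :=
  GRing.Zmodule_isLmodule.Build K (fock_end K) end_scaleA end_scale1
    end_scaleDr end_scaleDl.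

Lemma end_scaleAl (a : K) (f g : fock_end K) : a *: (f * g) = (a *: f) * g.
Proof. by apply/fock_endP. Qed.

HB.instance Definition _ :=
  GRing.Lmodule_isLalgebra.Build K (fock_end K) end_scaleAl.

Lemma end_scaleAr (a : K) (f g : fock_end K) : a *: (f * g) = f * (a *: g).
Proof. by apply/fock_endP => v; symmetry; apply: (linearZ_LR f). Qed.

HB.instance Definition _ :=
  GRing.Lalgebra_isAlgebra.Build K (fock_end K) end_scaleAr.

End FockEnd.

Section RibbonOperators.
Variables (K : fieldType) (q : K) (n : nat).

(* The mu with adds_ribbon n i la mu is unique when it exists. *)
Definition ribbon_image (i : int) (la : intpart) : fock K :=
  if pselect (exists mu, adds_ribbon n i la mu) is left ex_mu then
    let mu := xchoose ex_mu in q ^+ spin (skew mu la) *: << mu >>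
  else 0.

Definition ribbon_op (i : int) : fock_end K := lin_ext (ribbon_image i).

Lemma ribbon_opU i la : ribbon_op i << la >> = ribbon_image i la.
Proof. exact: lin_extU. Qed.

(* u_{i_k} ... u_{i_2} u_{i_1} for s = (i_1, ..., i_k). *)
Definition ribbon_word (s : seq int) : fock_end K :=
  \prod_(i <- rev s) ribbon_op i.

Definition increasing (k : nat) : set (k.-tuple int) :=
  [set s : k.-tuple int | sorted <%R s]%classic.
Arguments increasing : clear implicits.

Lemma diagram_bound la (b : box) : b \in diagram la ->
  (b.1 < #|` diagram la|%fset)%N /\ (b.2 < #|` diagram la|%fset)%N.
Proof.
rewrite inE => /allpairsPdep [r [c [rP cP ->]]] /=.
rewrite !mem_iota /= !add0n in rP cP.
have in_diag r' c' : (r' < size la)%N -> (c' < nth 0%N la r')%N ->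
    (r', c') \in diagram la.
  move=> rP' cP'; rewrite inE; apply/allpairsPdep.
  by exists r', c'; rewrite !mem_iota.
split.
  apply: leq_trans rP _; rewrite -[X in (X <= _)%N](size_iota 0).
  rewrite -(size_map (fun r' => (r', 0%N))); apply: uniq_leq_size.
    by rewrite map_inj_uniq ?iota_uniq // => x y [].
  move=> _ /mapP [r' + ->]; rewrite mem_iota => /= rP'; apply: in_diag => //.
  case: la rP' {cP} => la /= /andP [_ la0] rP'.
  by rewrite lt0n; apply: contraNneq la0 => <-; rewrite mem_nth.
apply: leq_trans cP _; rewrite -[X in (X <= _)%N](size_iota 0).
rewrite -(size_map (fun c' => (r, c'))); apply: uniq_leq_size.
  by rewrite map_inj_uniq ?iota_uniq // => x y [].
by move=> _ /mapP [c' + ->]; rewrite mem_iota => /= cP'; apply: in_diag.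
Qed.

Lemma ribbon_word_bound s la : ribbon_word s << la >> != 0 ->
  forall i, i \in s -> (`|i| <= #|` diagram la|%fset + n * size s)%N.
Proof.
elim: s la => // j s IH la.
rewrite /ribbon_word rev_cons -cats1 big_cat big_seq1 /=.
rewrite -[X in X != 0]/(ribbon_word s (ribbon_op j << la >>)).
rewrite ribbon_opU /ribbon_image.
case: pselect => [ex_mu|_]; last by rewrite linear0 eqxx.
move: (xchooseP ex_mu); set mu := xchoose ex_mu; rewrite /adds_ribbon.
case/and3P => sub_mu /andP [/eqP size_n _] /existsP [b /andP [_ /eqP bj]].
have size_mu : (#|` diagram mu| = #|` diagram la| + n)%N.
  rewrite -(cardfsID (diagram la)) -size_n; congr (_ + _)%N.
  by rewrite (fsetIidPr sub_mu).
rewrite linearZ /= => nz i; rewrite inE mulnS addnA -size_mu.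
case/predU1P => [->|i_s]; last first.
  by apply: IH i_s; apply: contraNneq nz => ->; rewrite scaler0.
have /diagram_bound [b1 b2] : val b \in diagram mu.
  by have := valP b; rewrite inE => /andP [].
apply: leq_trans (leq_addr _ _); rewrite -bj /diagonal.
move: (val b) b1 b2 => [r c] /= b1 b2; lia.
Qed.

Lemma finite_contributions k la :
  finite_set [set s : k.-tuple int | ribbon_word s << la >> != 0].
Proof.
pose B := (#|` diagram la| + n * k)%N.
pose f (t : k.-tuple 'I_(B + B).+1) := map_tuple (fun i : 'I__ => i%:Z - B%:Z) t.
apply: (@sub_finite_set _ _ (range f)); last exact/finite_image.
move=> s /ribbon_word_bound; rewrite size_tuple -/B => sB.
exists (map_tuple (fun i : int => inord `|i + B%:Z|) s) => //.
apply/val_inj; rewrite /= -map_comp -[RHS]map_id; apply/eq_in_map => i /sB /=.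
move=> iB; have i0 : 0 <= i + B%:Z by lia.
by rewrite inordK; lia.
Qed.

(* \sum_(s \in _) sums over the s with a nonzero contribution, of which there
   are finitely many by finite_contributions. *)
Definition h_op (k : nat) : fock_end K :=
  lin_ext (fun la => \sum_(s \in increasing k) ribbon_word s << la >>).

End RibbonOperators.

Section SymFun.
Variable K : fieldType.

Definition drop_last_var m (p : {mpoly K[m.+1]}) : {mpoly K[m]} :=
  p \mPo [tuple oapp (fun j : 'I_m => 'X_j) 0 (unlift ord_max i) | i < m.+1].

HB.instance Definition _ m :=
  GRing.Linear.copy (@drop_last_var m) (@comp_mpoly m.+1 K m _).
HB.instance Definition _ m :=
  GRing.RMorphism.copy (@drop_last_var m) (@comp_mpoly m.+1 K m _).

(* The ring of symmetric functions over K, as the inverse limit of the rings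
   K[x_1, ..., x_m]^{S_m} in the category of graded rings: compatible
   families, of bounded degree, of symmetric polynomials. *)
Definition compatible (f : forall m, {mpoly K[m]}) : Prop :=
  [/\ forall m, f m \is symmetric,
      forall m, drop_last_var (f m.+1) = f m &
      exists d, forall m, (msize (f m) <= d)%N].

Record symfun := SymFun {
  in_vars :> forall m, {mpoly K[m]};
  _ : compatible in_vars
}.

Implicit Types f g h : symfun.

HB.instance Definition _ := gen_eqMixin symfun.
HB.instance Definition _ := gen_choiceMixin symfun.

Lemma symfunP f g : (forall m, f m = g m) <-> f = g.
Proof.
split=> [fg|-> //]; have {fg} : in_vars f = in_vars g.
  exact: functional_extensionality_dep.
case: f g => f fP [g gP] /= fg.
by move: fP gP; rewrite {}fg => fP gP; rewrite (Prop_irrelevance fP gP).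
Qed.

Lemma compatible0 : compatible (fun=> 0).
Proof.
split=> [m|m|]; first exact: rpred0.
  by rewrite raddf0.
by exists 0%N => m; rewrite msize0.
Qed.

Lemma compatible1 : compatible (fun=> 1).
Proof.
split=> [m|m|]; first exact: rpred1.
  by rewrite rmorph1.
by exists 1%N => m; rewrite msize1.
Qed.

Lemma compatibleN f : compatible (fun m => - f m).
Proof.
case: f => f [fS fD [d fd]]; split=> [m|m|]; first by apply: rpredNr; exact: fS.
  by rewrite raddfN /= fD.
by exists d => m; rewrite msizeN.
Qed.

Lemma compatibleD f g : compatible (fun m => f m + g m).
Proof.
case: f g => f [fS fD [d fd]] [g [gS gD [e ge]]].
split=> [m|m|]; first by apply: rpredD; [exact: fS|exact: gS].
  by rewrite raddfD /= fD gD.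
exists (maxn d e) => m; apply: leq_trans (msizeD_le _ _) _.
by rewrite geq_max !leq_max fd ge orbT.
Qed.

Lemma compatibleM f g : compatible (fun m => f m * g m).
Proof.
case: f g => f [fS fD [d fd]] [g [gS gD [e ge]]].
split=> [m|m|]; first by apply: rpredM; [exact: fS|exact: gS].
  by rewrite rmorphM /= fD gD.
exists (d + e)%N => m /=; have [->|f0] := eqVneq (f m) 0.
  by rewrite mul0r msize0.
have [->|g0] := eqVneq (g m) 0; first by rewrite mulr0 msize0.
by rewrite msizeM //; apply: leq_trans (leq_pred _) (leq_add _ _).
Qed.

Lemma compatibleZ a f : compatible (fun m => a *: f m).
Proof.
case: f => f [fS fD [d fd]]; split=> [m|m|]; first by apply: rpredZ; exact: fS.
  by rewrite linearZ /= fD.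
by exists d => m; apply: leq_trans (msizeZ_le _ _) (fd m).
Qed.

Definition symfun_zero := SymFun compatible0.
Definition symfun_one := SymFun compatible1.
Definition symfun_opp f := SymFun (compatibleN f).
Definition symfun_add f g := SymFun (compatibleD f g).
Definition symfun_mul f g := SymFun (compatibleM f g).
Definition symfun_scale a f := SymFun (compatibleZ a f).

Lemma symfun_addA : associative symfun_add.
Proof. by move=> f g h; apply/symfunP => m; apply: addrA. Qed.
Lemma symfun_addC : commutative symfun_add.
Proof. by move=> f g; apply/symfunP => m; apply: addrC. Qed.
Lemma symfun_add0 : left_id symfun_zero symfun_add.
Proof. by move=> f; apply/symfunP => m; apply: add0r. Qed.
Lemma symfun_addN : left_inverse symfun_zero symfun_opp symfun_add.
Proof. by move=> f; apply/symfunP => m; apply: addNr. Qed.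

HB.instance Definition _ :=
  GRing.isZmodule.Build symfun symfun_addA symfun_addC symfun_add0 symfun_addN.

Lemma symfun_mulA : associative symfun_mul.
Proof. by move=> f g h; apply/symfunP => m; apply: mulrA. Qed.
Lemma symfun_mulC : commutative symfun_mul.
Proof. by move=> f g; apply/symfunP => m; apply: mulrC. Qed.
Lemma symfun_mul1 : left_id symfun_one symfun_mul.
Proof. by move=> f; apply/symfunP => m; apply: mul1r. Qed.
Lemma symfun_mulDl : left_distributive symfun_mul +%R.
Proof. by move=> f g h; apply/symfunP => m; apply: mulrDl. Qed.
Lemma symfun_oner_neq0 : symfun_one != 0.
Proof.
by apply/eqP => /symfunP /(_ 0%N) /= /eqP; rewrite oner_eq0.
Qed.

HB.instance Definition _ :=
  GRing.Zmodule_isComNzRing.Build symfun symfun_mulA symfun_mulC symfun_mul1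
    symfun_mulDl symfun_oner_neq0.

Lemma symfun_scaleA a b f :
  symfun_scale a (symfun_scale b f) = symfun_scale (a * b) f.
Proof. by apply/symfunP => m; apply: scalerA. Qed.
Lemma symfun_scale1 : left_id 1 symfun_scale.
Proof. by move=> f; apply/symfunP => m; apply: scale1r. Qed.
Lemma symfun_scaleDr : right_distributive symfun_scale +%R.
Proof. by move=> a f g; apply/symfunP => m; apply: scalerDr. Qed.
Lemma symfun_scaleDl f : {morph symfun_scale^~ f : a b / a + b}.
Proof. by move=> a b; apply/symfunP => m; apply: scalerDl. Qed.

HB.instance Definition _ :=
  GRing.Zmodule_isLmodule.Build K symfun symfun_scaleA symfun_scale1
    symfun_scaleDr symfun_scaleDl.

Lemma symfun_scaleAl (a : K) (f g : symfun) : a *: (f * g) = (a *: f) * g.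
Proof. by apply/symfunP => m; apply: scalerAl. Qed.

HB.instance Definition _ :=
  GRing.Lmodule_isLalgebra.Build K symfun symfun_scaleAl.
HB.instance Definition _ := GRing.Lalgebra_isComAlgebra.Build K symfun.

Definition complete_hom (k m : nat) : {mpoly K[m]} :=
  \sum_(x : 'X_{1..m < k.+1} | mdeg x == k) 'X_[x].

Lemma mcoeff_complete_hom k m (x : 'X_{1..m}) :
  (complete_hom k m)@_x = (mdeg x == k)%:R.
Proof.
rewrite /complete_hom raddf_sum /=; have [dx|dx] := boolP (mdeg x == k).
  have ltx : (mdeg x < k.+1)%N by rewrite (eqP dx).
  rewrite (bigD1 (BMultinom ltx)) //= mcoeffX eqxx big1 ?addr0 // => y.
  case/andP => _ yx; rewrite mcoeffX; case: eqP => // yE.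
  by case/eqP: yx; apply/val_inj.
rewrite big1 // => y dy; rewrite mcoeffX; case: eqP => // yE.
by case/negP: dx; rewrite -yE.
Qed.

Lemma widen_lift_max m (i : 'I_m) :
  widen_ord (leqnSn m) i = fintype.lift ord_max i :> 'I_m.+1.
Proof. by apply: val_inj; rewrite [RHS]lift_max. Qed.

Definition mnm_ext0 m (y : 'X_{1..m}) : 'X_{1..m.+1} :=
  [multinom oapp y 0%N (unlift ord_max i) | i < m.+1].

Lemma mdeg_ext0 m (y : 'X_{1..m}) : mdeg (mnm_ext0 y) = mdeg y.
Proof.
rewrite !mdegE big_ord_recr /= mnmE unlift_none addn0; apply: eq_bigr => i _.
by rewrite mnmE widen_lift_max liftK.
Qed.

Lemma mcoeff_drop_last_var m (p : {mpoly K[m.+1]}) (y : 'X_{1..m}) :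
  (drop_last_var p)@_y = p@_(mnm_ext0 y).
Proof.
rewrite [p in LHS]mpolyE [drop_last_var _]raddf_sum [p in RHS]mpolyE.
rewrite [in LHS]raddf_sum [in RHS]raddf_sum; apply: eq_bigr => x _ /=.
rewrite linearZ /= !mcoeffZ mcoeffX; congr (_ * _).
rewrite /drop_last_var comp_mpolyX big_ord_recr /= tnth_mktuple unlift_none /=.
pose x' := [multinom x (fintype.lift ord_max i) | i < m].
have -> : \prod_(i < m) tnth [tuple oapp (fun j : 'I_m => 'X_j) 0
    (unlift ord_max i) | i < m.+1] (widen_ord (leqnSn m) i)
    ^+ x (widen_ord (leqnSn m) i) = 'X_[x'] :> {mpoly K[m]}.
  rewrite mpolyXE_id; apply: eq_bigr => i _.
  by rewrite tnth_mktuple mnmE widen_lift_max liftK.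
rewrite expr0n; case: eqP => [x0|x0].
  rewrite mulr1 mcoeffX; congr (_%:R); congr (nat_of_bool _).
  rewrite /x'; apply/eqP/eqP => [<-|->]; apply/mnmP => i; rewrite !mnmE.
    by case: unliftP => [j ->|->] //=; rewrite mnmE.
  by rewrite liftK.
rewrite mulr0 mcoeff0; case: eqP => // xE; case: x0.
by rewrite xE mnmE unlift_none.
Qed.

Lemma drop_last_complete_hom k m :
  drop_last_var (complete_hom k m.+1) = complete_hom k m.
Proof.
apply/mpolyP => y.
by rewrite mcoeff_drop_last_var !mcoeff_complete_hom mdeg_ext0.
Qed.

Lemma compatible_complete_hom k : compatible (complete_hom k).
Proof.
split=> [m|m|]; last 1 first.
- exists k.+1 => m; rewrite msizeE; apply/bigmax_leqP_seq => x + _.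
  rewrite mcoeff_msupp mcoeff_complete_hom.
  by case: (mdeg x =P k) => [-> //|_]; rewrite eqxx.
- apply/issymP => s; apply/mpolyP => x.
  by rewrite mcoeff_sym !mcoeff_complete_hom mdeg_mperm.
- exact: drop_last_complete_hom.
Qed.

Definition hsym (k : nat) : symfun := SymFun (compatible_complete_hom k).

End SymFun.

Definition generated_subalgebra (K : fieldType) (A : algType K) (S : set A) :
    set A :=
  [set a | forall B : {pred A}, GRing.subalg_closed B ->
                                (forall s, S s -> s \in B) -> a \in B]%classic.

(* For pairwise commuting x_0, x_1, ... in a possibly noncommutative algebra. *)
Definition alg_independent (K : fieldType) (A : algType K) (x : nat -> A) :
    Prop :=
  forall (m : nat) (P : {mpoly K[m]}),
    mmap (in_alg A) (fun i : 'I_m => x i) P = 0 -> P = 0.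

(* The field C(q) and its generator q. *)
Definition Cq (R : realType) : fieldType := {fraction {poly R[i]}}.
Definition qvar (R : realType) : Cq R := tofrac 'X.

(* Main.v *)
(* Encode a partition la by its beads {la_r - r}. Adding an n-ribbon with head
   on diagonal i moves a bead from i - n + 1 to i + 1, and its spin is the
   number of beads jumped over. Hence, for i < j, u_j u_i = q^2 u_i u_j if
   j - i < n and u_j u_i = u_i u_j if j - i > n, while u_i^2, u_i u_(i+n) u_i
   and u_(i+n) u_i u_(i+n) vanish. From these relations the products
   E(x) = (1 + x u_b) ... (1 + x u_a) satisfy E(x) E(y) = E(y) E(x): for at
   most n factors E is a q-exponential, and longer products are treated by
   induction, through their two subproducts with one factor less. The h_k are
   locally coefficients of such products, so they commute.

   For injectivity, start from a partition with m rows whose lengths are far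
   apart and look only at partitions obtained from it by adding horizontal
   n-ribbons to these rows: on them h_k(u) acts as multiplication by the
   polynomial h_k(x_1, ..., x_m). A symmetric function that acts as 0 is thus 0
   in every number of variables. *)
Require Import Defs.
From HB Require Import structures.
From mathcomp Require Import all_boot all_order all_algebra.
From mathcomp Require Import finmap freeg mpoly.
From mathcomp Require Import boolp classical_sets functions fsbigop.
From mathcomp Require Import perm reals zify ring.
(* [diagonal] has been shadowed by the preceding imports. *)
Import Defs.

Set Implicit Arguments.
Unset Strict Implicit.
Unset Printing Implicit Defensive.

Import Order.TTheory GRing.Theory Num.Theory.

Local Open Scope ring_scope.

(** * Bead positions and ribbons *)

(** The relations leave the pair [u i], [u (i + n)] free except for the vanishing of two braid
    words. A window of at most n indices contains no such pair; in a longer one the commutator of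
    the two ends is the only obstruction, and the vanishing words strip it of its outer factors. The
    x of the generating products is a scalar of K, not an indeterminate. Coefficients are separated
    by comparing x with q x, which works because q is nonzero and not a root of unity. For
    injectivity, horizontal ribbons have spin 0, so no power of q enters. One increasing word may
    add several ribbons to the same row, since the indices of successive moves in a row grow by n;
    this is why complete rather than elementary polynomials appear. The operators also leave the
    family of spread partitions, but a partition outside it whose rows have at least their initial
    lengths never returns to the part of the family that is inspected. *)

Section Level.
Implicit Types (la mu : intpart) (c i j : int) (r k : nat) (b : box).

Lemma leq_parts la r k : (r <= k)%N -> (nth 0%N la k <= nth 0%N la r)%N.
Proof.
move=> rk; have [ks|sk] := ltnP k (size la); last by rewrite nth_default.
have [geq_trans geq_refl] : transitive geq /\ reflexive geq.
  by split=> [y x z /= yx zy|x /=]; [exact: leq_trans zy yx|exact: leqnn].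
have /andP [la_sorted _] := valP la.
by apply: (sorted_leq_nth geq_trans geq_refl) => //; apply: leq_ltn_trans ks.
Qed.

Lemma parts_neq0 la r : (nth 0%N la r == 0)%N = (size la <= r)%N.
Proof.
have [sr|rs] := leqP (size la) r; first by rewrite nth_default.
have /andP [_ la0] := valP la.
by apply/negP => /eqP la_r; case/negP: la0; rewrite -[X in X \in _]la_r mem_nth.
Qed.

Lemma eq_intpart la mu : (forall r, nth 0%N la r = nth 0%N mu r) -> la = mu.
Proof.
move=> eq_nth; apply/val_inj => /=.
have szE r : (size la <= r)%N = (size mu <= r)%N.
  by rewrite -!parts_neq0 eq_nth.
apply: (@eq_from_nth _ 0%N) => [|r _]; last exact: eq_nth.
by apply/anti_leq; rewrite szE leqnn -szE leqnn.
Qed.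

Lemma intpart_of (f : nat -> nat) (B : nat) :
  (forall r, f r.+1 <= f r)%N -> f B = 0%N ->
  exists la : intpart, forall r, nth 0%N la r = f r.
Proof.
move=> f_dec fB; have f_le r k : (r <= k)%N -> (f k <= f r)%N.
  move=> /subnK <-; elim: (k - r)%N => [|t IH] //.
  by apply: leq_trans IH; rewrite addSn; apply: f_dec.
have ex0 : exists r, f r == 0%N by exists B; rewrite fB.
case: (ex_minnP ex0) => m /eqP fm m_min.
have f_gt0 r : (r < m)%N -> f r != 0%N.
  by move=> rm; apply/negP => /m_min; rewrite leqNgt rm.
have sP : sorted geq (mkseq f m) && (0%N \notin mkseq f m).
  apply/andP; split.
    apply: (@path.homo_sorted _ _ f leq) => [x y /f_le //|].
    exact: (iota_sorted 0).
  apply/negP => /mapP [r]; rewrite mem_iota /= add0n => /f_gt0 + f0.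
  by rewrite -f0.
exists (IntPart sP) => r /=.
have [rm|mr] := ltnP r m; first by rewrite nth_mkseq.
rewrite nth_default ?size_mkseq //; apply/esym/eqP.
by rewrite -leqn0 -fm; apply: f_le.
Qed.

Lemma level_subproof la c : exists r, (nth 0%N la r)%:Z <= c + r%:Z.
Proof.
exists (size la + `|c|)%N; rewrite nth_default; last exact: leq_addr.
lia.
Qed.

(* The number of beads strictly to the right of c in the Maya diagram
   {la_r - r}; it is also the first row r whose box on diagonal c is not in
   la (when r + c >= 0). *)
Definition level la c : nat := ex_minn (level_subproof la c).

(** The bead positions la_r - r strictly decrease in r, so the beads to the right of c are those of
    an initial run of rows. *)
Lemma ltn_level la c r : (r < level la c)%N = (c + r%:Z < (nth 0%N la r)%:Z).
Proof.
rewrite /level; case: ex_minnP => m lam m_min.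
have [rm|mr] := ltnP r m.
  by rewrite real_ltNge ?num_real //; apply/esym/negP => /m_min; lia.
have := leq_parts la mr; lia.
Qed.

Lemma level_ge la c : - c <= (level la c)%:Z.
Proof.
rewrite real_leNgt ?num_real //; apply/negP => lc.
have := ltn_level la c (level la c); rewrite ltnn; lia.
Qed.

(** Position c + 1 carries at most one bead. *)
Lemma level_step la c :
  level la c = level la (c + 1) \/ level la c = (level la (c + 1)).+1.
Proof.
have := ltn_level la c (level la c); rewrite ltnn => H1.
have := ltn_level la (c + 1) (level la (c + 1)); rewrite ltnn => H2.
have H3 := ltn_level la (c + 1) (level la c).
have H4 := ltn_level la c (level la (c + 1)).+1.
have := @leq_parts la (level la (c + 1)) (level la (c + 1)).+1 (leqnSn _).
lia.
Qed.

Lemma level_eq0 la c : (nth 0%N la 0)%:Z <= c -> level la c = 0%N.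
Proof. by move=> lac; have := ltn_level la c 0; lia. Qed.

Lemma level_low la c : c <= - (size la)%:Z -> level la c = `|c|%N.
Proof.
move=> cs; have := ltn_level la c `|c|%N; rewrite nth_default; last by lia.
have := level_ge la c; lia.
Qed.

Lemma level_inj la mu : level la =1 level mu -> la = mu.
Proof.
move=> eq_lv; apply: eq_intpart => r.
have cellE k : (k < nth 0%N la r)%N = (k < nth 0%N mu r)%N.
  have := ltn_level la (k%:Z - r%:Z) r; rewrite eq_lv ltn_level. lia.
have := cellE (nth 0%N la r); have := cellE (nth 0%N mu r); lia.
Qed.

Lemma levelD la c k :
  (level la (c + k%:Z) <= level la c <= level la (c + k%:Z) + k)%N.
Proof.
elim: k => [|k /andP [IH1 IH2]]; first by rewrite addr0; lia.
have := level_step la (c + k%:Z).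
have -> : c + k%:Z + 1 = c + k.+1%:Z by lia.
lia.
Qed.

Lemma level_le la c c' : c <= c' -> (level la c' <= level la c)%N.
Proof.
move=> cc; have := levelD la c `|c' - c|%N.
have -> : c + `|c' - c|%N = c' by lia.
lia.
Qed.

(** The last two hypotheses say that all positions far to the left are filled and that the bead
    configuration has charge zero. *)
Lemma intpart_of_level (N : int -> nat) (B : nat) :
  (forall c, N c = N (c + 1) \/ N c = (N (c + 1)).+1) ->
  N B = 0%N -> (forall c, - c <= (N c)%:Z) -> N (- B%:Z) = B ->
  exists la, level la =1 N.
Proof.
move=> N_step N0 N_ge N_low.
have N_dec c k : (N (c + k%:Z)%R <= N c)%N.
  elim: k => [|k IH]; first by rewrite addr0.
  by have := N_step (c + k%:Z); (have -> : c + k%:Z + 1 = c + k.+1%:Z by lia); lia.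
have N_le c c' : c <= c' -> (N c' <= N c)%N.
  move=> cc; have := N_dec c `|c' - c|%N.
  by have -> : c + `|c' - c|%N = c' by lia.
have ex_f r : exists k, (N (k%:Z - r%:Z)%R <= r)%N.
  exists (B + r)%N; have -> : (B + r)%N%:Z - r%:Z = B%:Z by lia.
  by rewrite N0.
(* A box (r, k) is wanted exactly when r < N (k - r), so row r ends at the first k that fails. *)
pose f r := ex_minn (ex_f r).
have fP k r : (k < f r)%N = (r < N (k%:Z - r%:Z)%R)%N.
  rewrite /f; case: ex_minnP => m Nm m_min.
  have [km|mk] := ltnP k m.
    by apply/esym; rewrite ltnNge; apply/negP => /m_min; lia.
  have /N_le : m%:Z - r%:Z <= k%:Z - r%:Z by lia.
  lia.
have f_dec r : (f r.+1 <= f r)%N.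
  rewrite leqNgt fP; have := N_step ((f r)%:Z - r.+1%:Z).
  have -> : (f r)%:Z - r.+1%:Z + 1 = (f r)%:Z - r%:Z by lia.
  have := fP (f r) r; lia.
have fB : f B = 0%N.
  have := fP 0%N B; have -> : 0%:Z - B%:Z = - B%:Z by lia.
  lia.
have [la laE] := intpart_of f_dec fB; exists la => c.
have lvE r : (r < level la c)%N = (r < N c)%N.
  rewrite ltn_level laE; have [cr|cr] := ltP (c + r%:Z) 0; first by have := N_ge c; lia.
  have := fP `|(c + r%:Z)%R|%N r; have -> : `|(c + r%:Z)%R|%N%:Z - r%:Z = c by lia.
  lia.
have := lvE (N c); have := lvE (level la c); lia.
Qed.

Lemma mem_diagram la b : (b \in diagram la) = (b.1 < level la (diagonal b))%N.
Proof.
rewrite ltn_level /diagonal; case: b => r k /=.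
have -> : k%:Z - r%:Z + r%:Z = k by lia.
rewrite inE; apply/allpairsPdep/idP => [[r' [k' [_ + [-> ->]]]]|kr].
  by rewrite mem_iota add0n /=.
exists r, k; rewrite !mem_iota /= !add0n; split => //.
by rewrite ltnNge -parts_neq0; apply/negP => /eqP; lia.
Qed.

Lemma mem_skew la mu b : (b \in skew mu la) =
  (level la (diagonal b) <= b.1 < level mu (diagonal b))%N.
Proof. by rewrite in_fsetD !mem_diagram -leqNgt. Qed.

(* The first box of diagonal c outside la. *)
Definition rim_box la c : box := (level la c, `|(c + (level la c)%:Z)%R|%N).

Lemma diagonal_rim_box la c : diagonal (rim_box la c) = c.
Proof. by rewrite /diagonal /=; have := level_ge la c; lia. Qed.

Lemma rim_box_inj la : injective (rim_box la).
Proof. by move=> c c' /(congr1 diagonal); rewrite !diagonal_rim_box. Qed.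

Lemma adjacent_sym : ssrbool.symmetric adjacent.
Proof. by move=> [r c] [r' c']; rewrite /adjacent /=; lia. Qed.

Lemma adjacent_diagonal a b : adjacent a b -> diagonal b <= diagonal a + 1.
Proof. by move: a b => [r c] [r' c']; rewrite /adjacent /diagonal /=; lia. Qed.

Lemma adjacent_rim_box la c : adjacent (rim_box la c) (rim_box la (c + 1)).
Proof.
rewrite /adjacent /=.
have := level_step la c; have := level_ge la c; have := level_ge la (c + 1).
lia.
Qed.

Section Strip.
Variables (la mu : intpart) (j : int) (t : nat).
Hypothesis lvE : forall c, level mu c = (level la c + (j <= c < j + t%:Z)%R)%N.

Lemma skew_strip :
  skew mu la = [fset b in [seq rim_box la (j + s%:Z) | s <- iota 0 t]]%fset.
Proof.
apply/fsetP => b; rewrite mem_skew inE lvE; apply/idP/mapP => [bP|[s + ->]].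
  exists `|diagonal b - j|%N; first by rewrite mem_iota; lia.
  have -> : j + `|diagonal b - j|%N = diagonal b by lia.
  have := level_ge la (diagonal b).
  case: b bP => r k; rewrite /diagonal /= => bP lvb.
  by rewrite /rim_box; congr (_, _); lia.
by rewrite mem_iota diagonal_rim_box /= => st; lia.
Qed.

Lemma card_strip : #|` skew mu la|%fset = t.
Proof.
rewrite skew_strip card_fseq undup_id ?size_map ?size_iota //.
rewrite map_inj_uniq ?iota_uniq // => s s' /rim_box_inj; lia.
Qed.

Lemma rim_box_strip c : (rim_box la c \in skew mu la) = (j <= c < j + t%:Z).
Proof. by rewrite mem_skew diagonal_rim_box lvE /=; lia. Qed.

Lemma strip_rim_box b : b \in skew mu la -> b = rim_box la (diagonal b).
Proof. by rewrite skew_strip inE => /mapP [s _ ->]; rewrite diagonal_rim_box. Qed.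

Lemma strip_diagonal b : b \in skew mu la -> j <= diagonal b < j + t%:Z.
Proof. by move=> bD; rewrite -rim_box_strip -strip_rim_box. Qed.

Lemma strip_no_square : ~~ has_square (skew mu la).
Proof.
apply/negP => /existsP [x /and3P [_ _]]; have := valP x.
rewrite !mem_skew !lvE; case: (val x) => r k; rewrite /diagonal /=.
have -> : k.+1%:Z - r.+1%:Z = k%:Z - r%:Z by lia.
lia.
Qed.

Lemma strip_connected : connected_shape (skew mu la).
Proof.
pose e (a b : skew mu la) := adjacent (val a) (val b).
have e_sym : connect_sym e.
  by apply: sym_connect_sym => a b; apply: adjacent_sym.
have connD (x y : skew mu la) k : diagonal (val y) = diagonal (val x) + k%:Z -> connect e x y.
  elim: k x => [|k IH] x.
    rewrite addr0 => xy; suff -> : x = y by [].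
    by apply/val_inj; rewrite (strip_rim_box (valP x)) -xy -strip_rim_box ?(valP y).
  move=> xy; have zD : rim_box la (diagonal (val x) + 1) \in skew mu la.
    rewrite rim_box_strip.
    by have := strip_diagonal (valP x); have := strip_diagonal (valP y); lia.
  have zE : val [` zD]%fset = rim_box la (diagonal (val x) + 1) by [].
  apply: (@connect_trans _ _ [` zD]%fset); last first.
    by apply: IH; rewrite xy zE diagonal_rim_box; lia.
  apply: connect1; rewrite /e zE {1}(strip_rim_box (valP x)).
  exact: adjacent_rim_box.
have conn (x y : skew mu la) : connect e x y.
  have [xy|yx] := leP (diagonal (val x)) (diagonal (val y)).
    by apply: (connD _ _ `|diagonal (val y) - diagonal (val x)|%N); lia.
  rewrite e_sym.
  by apply: (connD _ _ `|diagonal (val x) - diagonal (val y)|%N); lia.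
by apply/forallP => x; apply/forallP => y; apply: conn.
Qed.

Lemma strip_head c : c = j + t%:Z - 1 -> (0 < t)%N ->
  is_head (skew mu la) (rim_box la c).
Proof.
move=> cE t0; apply/andP; split; first by rewrite rim_box_strip; lia.
apply/forallP => x; move: (val x) (valP x) => b bD.
have := strip_diagonal bD; rewrite (strip_rim_box bD) diagonal_rim_box /= => bc.
have := levelD la (diagonal b) `|c - diagonal b|%N.
have -> : diagonal b + `|c - diagonal b|%N = c by lia.
by have := level_ge la c; have := level_ge la (diagonal b); lia.
Qed.

(** From one box of the strip to the next the row changes by at most one, so the rows met fill the
    interval between the end values. *)
Lemma spin_strip : (0 < t)%N ->
  spin (skew mu la) = (level la j - level la (j + t%:Z - 1))%N.
Proof.
move=> t0; have lv_le := levelD la j t.-1.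
have lastE : j + t.-1%:Z = j + t%:Z - 1 by lia.
rewrite lastE in lv_le.
rewrite /spin; set l := level la (j + t%:Z - 1).
suff -> : [fset b.1 | b : box in skew mu la]%fset
    = [fset r in iota l (level la j - l).+1]%fset.
  by rewrite card_fseq undup_id ?iota_uniq // size_iota.
have lv_mem r : (l <= r <= level la j)%N ->
    exists2 s, (s < t)%N & r = level la (j + s%:Z).
  rewrite /l -lastE -[in X in _ -> X](prednK t0).
  elim: t.-1 => [|k IH].
    by rewrite addr0 -eqn_leq => /eqP <-; exists 0%N; rewrite ?addr0.
  have := level_step la (j + k%:Z).
  have -> : j + k%:Z + 1 = j + k.+1%:Z by lia.
  move=> step /andP [lr rj]; have [rk|rk] := eqVneq r (level la (j + k.+1%:Z)).
    by exists k.+1.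
  have [|s sk ->] := IH; first by lia.
  by exists s => //; lia.
have memI r m k : (r \in [fset x in iota m k]%fset) = (m <= r < m + k)%N.
  by rewrite inE /= mem_iota.
apply/fsetP => r; rewrite [RHS]memI; apply/imfsetP/idP.
  move=> [b /= /[dup] /strip_diagonal bj /strip_rim_box -> -> /=].
  have := levelD la j `|diagonal b - j|%N.
  have -> : j + `|diagonal b - j|%N = diagonal b by lia.
  have := levelD la (diagonal b) `|(j + t%:Z - 1 - diagonal b)%R|%N.
  have -> : diagonal b + `|(j + t%:Z - 1 - diagonal b)%R|%N = j + t%:Z - 1 by lia.
  by rewrite -/l; lia.
move=> rl; have [|s st rE] := lv_mem r; first by lia.
exists (rim_box la (j + s%:Z)) => //=.
by rewrite rim_box_strip; lia.
Qed.

End Strip.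

(** From the shape to the levels: the absence of squares leaves at most one box per diagonal,
    connectedness makes the occupied diagonals an interval, and the head fixes its right end. *)
Lemma adds_ribbonP n i la mu : (0 < n)%N ->
  reflect (forall c, level mu c = (level la c + (i + 1 - n%:Z <= c < i + 1)%R)%N)
          (adds_ribbon n i la mu).
Proof.
move=> n0; apply: (iffP idP) => [|lvE]; last first.
  have {}lvE c : level mu c
      = (level la c + (i + 1 - n%:Z <= c < i + 1 - n%:Z + n%:Z)%R)%N.
    by rewrite lvE; lia.
  apply/and3P; split.
  - by apply/fsubsetP => b; rewrite !mem_diagram lvE; lia.
  - apply/and3P; split; first by rewrite (card_strip lvE).
      exact: strip_connected lvE.
    exact: strip_no_square lvE.
  - have bD : rim_box la i \in skew mu la by rewrite (rim_box_strip lvE); lia.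
    apply/existsP; exists [` bD]%fset; rewrite /= diagonal_rim_box eqxx andbT.
    by apply: (strip_head lvE) => //; lia.
case/and3P => /fsubsetP sub /and3P [/eqP card_D conn nosq].
case/existsP => h /andP [/andP [_ /forallP h_head] /eqP hi].
have lv_le c : (level la c <= level mu c)%N.
  have [//|lt_lv] := leqP (level la c) (level mu c).
  pose b : box := (level mu c, `|(c + (level mu c)%:Z)%R|%N).
  have bc : diagonal b = c.
    by rewrite /diagonal /=; have := level_ge mu c; lia.
  by have := sub b; rewrite !mem_diagram bc lt_lv ltnn => /(_ isT).
(* Two boxes on diagonal c would form a square with the boxes between them on diagonals c - 1 and c
   + 1. *)
have lv_leS c : (level mu c <= level la c + 1)%N.
  rewrite leqNgt; apply/negP => lt_lv; case/negP: nosq.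
  pose r := level la c; pose k := `|(c + r%:Z)%R|%N.
  have kE : k%:Z = c + r%:Z by rewrite /k /r; have := level_ge la c; lia.
  have r1E : k.+1%:Z - r%:Z = c + 1 by lia.
  have r2E : k%:Z - r.+1%:Z = c - 1 by lia.
  have r3E : k.+1%:Z - r.+1%:Z = c by lia.
  have r4E : k%:Z - r%:Z = c by lia.
  have bD : (r, k) \in skew mu la.
    by rewrite mem_skew /diagonal /= r4E /r; lia.
  have := level_step la c; have := level_step mu c.
  have := level_step la (c - 1); have := level_step mu (c - 1).
  have -> : c - 1 + 1 = c by lia.
  move=> s1 s2 s3 s4.
  apply/existsP; exists [` bD]%fset; rewrite /= !mem_skew /diagonal /= r1E r2E r3E /r.
  by apply/and3P; split; lia.
have diagP c : (level la c < level mu c)%N -> rim_box la c \in skew mu la.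
  by rewrite mem_skew diagonal_rim_box leqnn.
have Ddiag b : b \in skew mu la -> (level la (diagonal b) < level mu (diagonal b))%N.
  by rewrite mem_skew => /andP [/leq_ltn_trans H /H].
have le_i c : (level la c < level mu c)%N -> c <= i.
  move=> /diagP bD; have := h_head [` bD]%fset; rewrite /= -hi -[c](diagonal_rim_box la).
  by rewrite /diagonal /=; lia.
have lv_i : (level la i < level mu i)%N by rewrite -hi Ddiag ?(valP h).
(* If diagonal c + 1 were empty, the boxes on diagonals at most c would be closed under adjacency,
   hence cut off from the head. *)
have up c : c < i -> (level la c < level mu c)%N -> (level la (c + 1) < level mu (c + 1))%N.
  move=> ci lvc; rewrite ltnNge; apply/negP => lvc1.
  have bD := diagP _ lvc; pose e (x y : skew mu la) := adjacent (val x) (val y).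
  have a_closed : closed e [pred x : skew mu la | diagonal (val x) <= c].
    have cl (x y : skew mu la) : e x y -> diagonal (val x) <= c -> diagonal (val y) <= c.
      move=> /adjacent_diagonal + xc; have := Ddiag _ (valP y).
      move: (diagonal (val x)) xc (diagonal (val y)) => dx xc dy lvy xy.
      have [yc|yc] : dy <= c \/ dy = c + 1 by lia.
        by [].
      by move: lvy; rewrite yc; lia.
    move=> x y xy; apply/idP/idP; first exact: cl.
    by apply: cl; rewrite /e adjacent_sym.
  have := closed_connect a_closed (forallP (forallP conn [` bD]%fset) h).
  by rewrite !inE [val [` bD]%fset]/= diagonal_rim_box hi; lia.
(* Far to the left both levels equal |c|, so the run of occupied diagonals stops; counting boxes
   then identifies its length t with n. *)
have ex_t : exists t : nat, level mu (i - t%:Z) == level la (i - t%:Z).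
  pose t := (`|i| + size la + size mu)%N; exists t.
  by rewrite !level_low //; rewrite /t; lia.
case: (ex_minnP ex_t) => t /eqP lv_t t_min.
have lv_lt s : (s < t)%N -> (level la (i - s%:Z) < level mu (i - s%:Z))%N.
  move=> st; rewrite ltn_neqAle lv_le andbT eq_sym; apply/negP => /t_min; lia.
have lv_ge s : (t <= s)%N -> level mu (i - s%:Z) = level la (i - s%:Z).
  move=> /subnK <-; elim: (s - t)%N => [//|k IH].
  apply/eqP; rewrite eqn_leq lv_le andbT leqNgt; apply/negP => /up.
  have -> : i - (k.+1 + t)%N%:Z + 1 = i - (k + t)%N%:Z by lia.
  by rewrite IH; lia.
have lvE c : level mu c = (level la c + (i + 1 - t%:Z <= c < i + 1 - t%:Z + t%:Z)%R)%N.
  have [ci|ic] := leP c i; last first.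
    have := le_i c; have := lv_le c; lia.
  have cE : c = i - `|(i - c)%R|%N%:Z by lia.
  have [st|ts] := ltnP `|(i - c)%R|%N t.
    by have := lv_lt _ st; rewrite -cE; have := lv_leS c; lia.
  by have := lv_ge _ ts; rewrite -cE => ->; lia.
move=> c; rewrite -card_D (card_strip lvE) lvE; lia.
Qed.

End Level.

Lemma fock_linear_ext (K : fieldType) (M : lmodType K) (f g : {linear fock K -> M}) :
  (forall la, f << la >> = g << la >>) -> f =1 g.
Proof.
move=> fg v; rewrite -(freeg_sumE v) !linear_sum; apply: eq_bigr => la _ /=.
have -> : << coeff la v *g la >> = coeff la v *: (<< la >> : fock K).
  by apply/eqP/freeg_eqP => mu; rewrite coeffZ !coeffU mul1r.
by rewrite !linearZ fg.
Qed.

Lemma fock_end_ext (K : fieldType) (f g : fock_end K) :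
  (forall la, f << la >> = g << la >>) -> f = g.
Proof. by move=> fg; apply/fock_endP => v; apply: fock_linear_ext. Qed.

Lemma coeff_fock_linear (K : fieldType) (f : {linear fock K -> fock K}) mu v :
  coeff mu (f v) = \sum_(la <- dom v) coeff la v * coeff mu (f << la >>).
Proof.
rewrite -{1}(freeg_sumE v) linear_sum raddf_sum; apply: eq_bigr => la _ /=.
have -> : << coeff la v *g la >> = coeff la v *: (<< la >> : fock K).
  by apply/eqP/freeg_eqP => nu; rewrite coeffZ !coeffU mul1r.
by rewrite linearZ coeffZ.
Qed.

(** * Ribbon operators as bead moves, and their relations *)

Section RibbonMoves.
Variables (K : fieldType) (q : K) (n : nat).
Hypothesis n_gt0 : (0 < n)%N.
Implicit Types (la mu : intpart) (c i j : int) (v : fock K).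

Local Notation u := (ribbon_op q n).

(* mu is obtained from la by moving a bead from position i - n + 1 to the
   empty position i + 1. *)
Definition raises i la mu : Prop :=
  forall c, level mu c = (level la c + (i - n%:Z < c <= i)%R)%N.

Definition raisable i la : bool :=
  (level la (i - n%:Z + 1) < level la (i - n%:Z))%N
  && (level la (i + 1) == level la i).

(** The default value [la] for an impossible move is always guarded by [raisable]. *)
Definition raise i la : intpart :=
  if pselect (exists mu, raises i la mu) is left ex_mu then projT1 (cid ex_mu)
  else la.

(** Counts the beads strictly between positions i - n + 1 and i + 1. *)
Definition bead_spin i la : nat := (level la (i - n%:Z + 1) - level la i)%N.

Lemma raises_raisable i la mu : raises i la mu -> raisable i la.
Proof.
move=> lvE; rewrite /raisable.
have := level_step mu (i - n%:Z); have := level_step mu i; rewrite !lvE.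
have := level_step la (i - n%:Z); have := level_step la i; lia.
Qed.

Lemma level_raise i la c : raisable i la ->
  level (raise i la) c = (level la c + (i - n%:Z < c <= i)%R)%N.
Proof.
move=> /andP [lv1 /eqP lv2]; rewrite /raise; case: pselect => [ex_mu|no_mu].
  exact: projT2 (cid ex_mu) c.
case: no_mu; pose B := (`|i|%N + n + size la + nth 0%N la 0)%N.
apply: (@intpart_of_level (fun c => level la c + (i - n%:Z < c <= i)%R)%N B).
- move=> c'; have := level_step la c'.
  have [->|c1] := eqVneq c' (i - n%:Z); first by lia.
  have [->|c2] := eqVneq c' i; first by lia.
  lia.
- by rewrite level_eq0 /B; lia.
- by move=> c'; have := level_ge la c'; lia.
- by rewrite level_low /B; lia.
Qed.

Lemma raisableP i la mu : reflect (raises i la mu)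
  (raisable i la && (raise i la == mu)).
Proof.
apply: (iffP andP) => [[la_i /eqP <-] c|raise_mu]; first exact: level_raise.
have la_i := raises_raisable raise_mu; split=> //; apply/eqP/level_inj => c.
by rewrite level_raise // raise_mu.
Qed.

Lemma ribbon_op_raise i la :
  u i << la >> = if raisable i la then q ^+ bead_spin i la *: << raise i la >> else 0.
Proof.
have addsP mu : reflect (raises i la mu) (adds_ribbon n i la mu).
  apply: (iffP (adds_ribbonP i la mu n_gt0)) => lvE c; rewrite lvE; lia.
rewrite ribbon_opU /ribbon_image; case: pselect => [ex_mu|no_mu]; last first.
  case: ifP => // la_i; case: no_mu; exists (raise i la).
  by apply/addsP => c; apply: level_raise.
have /addsP := xchooseP ex_mu; set mu := xchoose ex_mu => lvE.
have /raisableP/andP [-> /eqP ->] := lvE.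
rewrite (@spin_strip la mu (i - n%:Z + 1) n) //; last by move=> c; rewrite lvE; lia.
by have -> : i - n%:Z + 1 + n%:Z - 1 = i by lia.
Qed.

Lemma ribbon_op_swap i j k :
  (forall la, raisable i la && raisable j (raise i la)
            = raisable j la && raisable i (raise j la)) ->
  (forall la, raisable i la -> raisable j (raise i la) ->
     raisable j la -> raisable i (raise j la) ->
     bead_spin i la + bead_spin j (raise i la)
     = k + (bead_spin j la + bead_spin i (raise j la)))%N ->
  u j * u i = q ^+ k *: (u i * u j).
Proof.
move=> raisableC spinC; apply: fock_end_ext => la.
rewrite -[LHS]/(u j (u i << la >>)) -[RHS]/(q ^+ k *: u i (u j << la >>)).
have := raisableC la; have := spinC la.
rewrite !ribbon_op_raise; case: ifP => la_i; case: ifP => la_j; rewrite ?raddf0 ?scaler0 //.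
- rewrite !linearZ !ribbon_op_raise /=.
  case: ifP => la_ij; case: ifP => la_ji //; rewrite ?scaler0 //.
  move=> /(_ isT isT isT isT) spinE _.
  have -> : raise j (raise i la) = raise i (raise j la).
    by apply/level_inj => c; rewrite !level_raise //; lia.
  by rewrite !scalerA -!exprD spinE addnA (addnC k).
- by move=> _; rewrite linearZ ribbon_op_raise => /= ->; rewrite scaler0.
- by move=> _; rewrite linearZ ribbon_op_raise => /= <-; rewrite !scaler0.
Qed.

(** The two jumps interlace. If i moves first, its bead passes the one waiting at j - n + 1 and is
    then itself passed at i + 1; in the other order neither bead passes the other. *)
Lemma ribbon_op_qcomm i j : i < j < i + n%:Z -> u j * u i = q ^+ 2 *: (u i * u j).
Proof.
move=> ij; apply: ribbon_op_swap => la.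
  have := level_step la (i - n%:Z); have := level_step la i.
  have := level_step la (j - n%:Z); have := level_step la j.
  case la_i: (raisable i la); case la_j: (raisable j la) => //=;
  move: la_i la_j; rewrite /raisable => la_i la_j; rewrite ?level_raise //; lia.
move=> la_i la_ij la_j la_ji; rewrite /bead_spin !level_raise //.
have := levelD la (i - n%:Z + 1) n.-1; have := levelD la (j - n%:Z + 1) n.-1.
have -> : i - n%:Z + 1 + n.-1%:Z = i by lia.
have -> : j - n%:Z + 1 + n.-1%:Z = j by lia.
have := @level_le (raise j la) (i - n%:Z + 1) i.
rewrite !level_raise //; lia.
Qed.

Lemma ribbon_op_comm i j : i + n%:Z < j -> u j * u i = u i * u j.
Proof.
move=> ij; rewrite -[RHS]scale1r -(expr0 q); apply: ribbon_op_swap => la.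
  have := level_step la (i - n%:Z); have := level_step la i.
  have := level_step la (j - n%:Z); have := level_step la j.
  case la_i: (raisable i la); case la_j: (raisable j la) => //=;
  move: la_i la_j; rewrite /raisable => la_i la_j; rewrite ?level_raise //; lia.
by move=> la_i la_ij la_j la_ji; rewrite /bead_spin !level_raise //; lia.
Qed.

Lemma ribbon_op_sqr i : u i * u i = 0.
Proof.
apply: fock_end_ext => la; rewrite -[LHS]/(u i (u i << la >>)) ribbon_op_raise.
case: ifP => la_i; last exact: raddf0.
rewrite linearZ ribbon_op_raise /=; case: ifP => [|_]; last exact: scaler0.
move: (la_i); rewrite /raisable !level_raise //.
by have := level_step la (i - n%:Z); lia.
Qed.

(** The first move empties position i - n + 1 and the second does not refill it. *)
Lemma ribbon_op_braid_up i : u i * u (i + n%:Z) * u i = 0.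
Proof.
apply: fock_end_ext => la; rewrite -[LHS]/(u i (u (i + n%:Z) (u i << la >>))).
rewrite ribbon_op_raise; case: ifP => la_i; last by rewrite !raddf0.
rewrite !linearZ ribbon_op_raise /=.
case: ifP => la_ij; last by rewrite raddf0 scaler0.
rewrite linearZ ribbon_op_raise /=; case: ifP => [|_]; last by rewrite !scaler0.
move: (la_i); rewrite /raisable !level_raise //.
by have := level_step la (i - n%:Z); lia.
Qed.

(** The first move fills position i + n + 1 and the second does not empty it. *)
Lemma ribbon_op_braid_down i : u (i + n%:Z) * u i * u (i + n%:Z) = 0.
Proof.
apply: fock_end_ext => la.
rewrite -[LHS]/(u (i + n%:Z) (u i (u (i + n%:Z) << la >>))).
rewrite ribbon_op_raise; case: ifP => la_i; last by rewrite !raddf0.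
rewrite !linearZ ribbon_op_raise /=.
case: ifP => la_ij; last by rewrite raddf0 scaler0.
rewrite linearZ ribbon_op_raise /=; case: ifP => [|_]; last by rewrite !scaler0.
move: (la_i); rewrite /raisable !level_raise //.
by have := level_step la (i + n%:Z); lia.
Qed.

Lemma coeff_ribbon_opU i la mu :
  coeff mu (u i << la >>) = (raisable i la && (raise i la == mu))%:R * q ^+ bead_spin i la.
Proof.
rewrite ribbon_op_raise; case: ifP => _; last by rewrite coeff0 mul0r.
by rewrite coeffZ coeffU mul1r mulrC.
Qed.

Lemma coeff_ribbon_op i la mu v : raises i la mu ->
  coeff mu (u i v) = q ^+ bead_spin i la * coeff la v.
Proof.
move=> la_mu; have la_uniq nu : raises i nu mu -> nu = la.
  by move=> nu_mu; apply/level_inj => c; have := la_mu c; have := nu_mu c; lia.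
rewrite coeff_fock_linear; have [la_v|la_v] := boolP (la \in dom v).
  rewrite (bigD1_seq la) ?uniq_dom //= big1 ?addr0 => [|nu nu_la].
    by rewrite coeff_ribbon_opU (introT (raisableP _ _ _) la_mu) mul1r mulrC.
  rewrite coeff_ribbon_opU; case: raisableP => [/la_uniq nuE|_].
    by rewrite nuE eqxx in nu_la.
  by rewrite mul0r mulr0.
rewrite coeff_outdom // mulr0 big1_seq // => nu /andP [_ nu_v].
rewrite coeff_ribbon_opU; case: raisableP => [/la_uniq nuE|_].
  by rewrite nuE (negbTE la_v) in nu_v.
by rewrite mul0r mulr0.
Qed.

Lemma coeff_ribbon_op0 i mu v : (forall la, ~ raises i la mu) -> coeff mu (u i v) = 0.
Proof.
move=> no_la; rewrite coeff_fock_linear big1_seq // => nu _.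
by rewrite coeff_ribbon_opU; case: raisableP => [/no_la//|_]; rewrite mul0r mulr0.
Qed.

End RibbonMoves.

(** * Commutation of the generating products *)

Section WindowProduct.
Variables (K : fieldType) (A : algType K) (Q : K) (v : nat -> A) (n : nat).
Hypothesis n_gt0 : (0 < n)%N.
Hypothesis Q_neq0 : Q != 0.
Hypothesis v_qcomm : forall i j, (i < j < i + n)%N -> v j * v i = Q *: (v i * v j).
Hypothesis v_comm : forall i j, (i + n < j)%N -> v j * v i = v i * v j.
Hypothesis v_sqr : forall i, v i * v i = 0.
Hypothesis v_up : forall i, v i * v (i + n)%N * v i = 0.
Hypothesis v_down : forall i, v (i + n)%N * v i * v (i + n)%N = 0.

Fixpoint wprod m l x : A :=
  if l is l'.+1 then (1 + x *: v (m + l')%N) * wprod m l' x else 1.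

Fixpoint wprod_inv m l x : A :=
  if l is l'.+1 then wprod_inv m l' x * (1 - x *: v (m + l')%N) else 1.

Lemma wprod_recl m l x : wprod m l.+1 x = wprod m.+1 l x * (1 + x *: v m).
Proof.
elim: l => [|l IH]; first by rewrite /= addn0 mulr1 mul1r.
by rewrite [LHS]/= -/(wprod m l.+1 x) IH mulrA /= addnS addSn.
Qed.

Lemma mul_1D1B x i : (1 + x *: v i) * (1 - x *: v i) = 1.
Proof.
rewrite mulrDl mul1r mulrBr mulr1 -scalerAl -scalerAr v_sqr !scaler0 subr0.
by rewrite addrNK.
Qed.

Lemma mul_1B1D x i : (1 - x *: v i) * (1 + x *: v i) = 1.
Proof. by rewrite -[in RHS](mul_1D1B (- x) i) !scaleNr opprK. Qed.

Lemma wprodK m l x : wprod m l x * wprod_inv m l x = 1.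
Proof.
elim: l => [|l IH]; first by rewrite mulr1.
by rewrite /= mulrA -[_ * _ * wprod_inv _ _ _]mulrA IH mulr1 mul_1D1B.
Qed.

Lemma wprodKV m l x : wprod_inv m l x * wprod m l x = 1.
Proof.
elim: l => [|l IH]; first by rewrite mulr1.
by rewrite /= mulrA -[_ * _ * (1 + _)]mulrA mul_1B1D mulr1.
Qed.

Definition wcomm m l := forall x y, wprod m l x * wprod m l y = wprod m l y * wprod m l x.

Lemma wprod_inv_comm m l x y : wcomm m l ->
  wprod_inv m l x * wprod_inv m l y = wprod_inv m l y * wprod_inv m l x.
Proof.
move=> Ecomm; set P := wprod m l x; set R := wprod m l y.
set Pi := wprod_inv m l x; set Ri := wprod_inv m l y.
have PPi : P * Pi = 1 by apply: wprodK.
have RRi : R * Ri = 1 by apply: wprodK.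
have PiP : Pi * P = 1 by apply: wprodKV.
have RiR : Ri * R = 1 by apply: wprodKV.
have PR : P * R = R * P by apply: Ecomm.
have inv1 : P * R * (Ri * Pi) = 1 by rewrite mulrA -[P * R * Ri]mulrA RRi mulr1.
have inv2 : Pi * Ri * (P * R) = 1 by rewrite PR mulrA -[Pi * Ri * R]mulrA RiR mulr1.
by rewrite -[LHS]mulr1 -inv1 mulrA inv2 mul1r.
Qed.

(** Every index of the window lies below j by less than n, so each [v] contributes the same factor
    Q, which x absorbs. *)
Lemma mul_wprod j m l x : (m + l <= j)%N -> (j < m + n)%N ->
  v j * wprod m l x = wprod m l (Q * x) * v j.
Proof.
move=> + jm; elim: l => [|l IH] lj; first by rewrite mulr1 mul1r.
rewrite /= -mulrA -IH; last by lia.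
rewrite !mulrA; congr (_ * _).
rewrite mulrDr mulrDl mulr1 mul1r -scalerAr v_qcomm; last by lia.
by rewrite scalerA -scalerAl (mulrC x).
Qed.

Lemma wprod_mul i m l x : (i < m)%N -> (m + l <= i + n)%N ->
  wprod m l x * v i = v i * wprod m l (Q * x).
Proof.
move=> im; elim: l => [|l IH] li; first by rewrite mulr1 mul1r.
rewrite /= -mulrA IH; last by lia.
rewrite !mulrA; congr (_ * _).
rewrite mulrDr mulrDl mulr1 mul1r -scalerAl v_qcomm; last by lia.
by rewrite scalerA -scalerAr (mulrC x).
Qed.

Definition wsum m l : A := \sum_(i < l) v (m + i)%N.

(* wprod m l is a q-exponential: it solves this q-difference equation. *)
Lemma wprod_qexp m l x : (l <= n)%N ->
  wprod m l x = (1 - ((Q - 1) * x) *: wsum m l) * wprod m l (Q * x).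
Proof.
elim: l => [|l IH] ln; first by rewrite /wsum big_ord0 scaler0 subr0 mulr1.
rewrite /= [in LHS]IH; last by lia.
rewrite !mulrA; congr (_ * _).
rewrite /wsum big_ord_recr /= -/(wsum m l); set b := v (m + l)%N; set h := wsum m l.
have bh : b * h = Q *: (h * b).
  rewrite /h /wsum mulr_sumr mulr_suml scaler_sumr; apply: eq_bigr => i _.
  by apply: v_qcomm; have := ltn_ord i; lia.
have bb : b * b = 0 by apply: v_sqr.
set z := (Q - 1) * x.
rewrite mulrDl mul1r mulrBr mulr1 -!scalerAl -!scalerAr bh.
rewrite mulrDr mulr1 mulrBl mul1r -!scalerAl -!scalerAr mulrDl bb addr0.
rewrite !scalerDr !scalerA.
have -> : (Q * x) *: b = x *: b + z *: b.
  by rewrite -scalerDl; congr (_ *: _); rewrite /z; ring.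
have -> : z * (Q * x) = x * z * Q by ring.
rewrite opprD -!addrA; congr (_ + (_ + _)).
by rewrite [X in _ = _ + X]addrCA addKr.
Qed.

(** The scalars on the right are symmetric in x and y, so commutation passes from length l to length
    l + 1. *)
Lemma wprod_mul_qexp m l x y : (l < n)%N ->
  wprod m l.+1 x * wprod m l.+1 y = wprod m l x * wprod m l y +
    ((x + y) *: (wprod m l (Q * x) * wprod m l (Q * y))
     - ((Q - 1) * (x * y)) *:
       (wsum m l * (wprod m l (Q * x) * wprod m l (Q * y)))) * v (m + l)%N.
Proof.
move=> ln /=; set b := v (m + l)%N.
have bE z : b * wprod m l z = wprod m l (Q * z) * b by apply: mul_wprod; lia.
rewrite ![(1 + _) * _]mulrDl !mul1r -!scalerAl !bE.
set P := wprod m l x; set R := wprod m l y.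
set P' := wprod m l (Q * x); set R' := wprod m l (Q * y).
rewrite mulrDl !mulrDr -!addrA; congr (_ + _).
have -> : x *: (P' * b) * (y *: (R' * b)) = 0.
  rewrite -scalerAl -scalerAr -mulrA [b * (_ * _)]mulrA bE -mulrA v_sqr.
  by rewrite !mulr0 !scaler0.
rewrite addr0 -scalerAl -(mulrA P') bE -/R' -scalerAr.
have -> : P * (R' * b) = P' * (R' * b)
    - ((Q - 1) * x) *: (wsum m l * (P' * (R' * b))).
  rewrite /P wprod_qexp; last by lia.
  by rewrite -/P' -mulrA mulrBl mul1r -scalerAl.
rewrite [RHS]mulrBl -!scalerAl -!mulrA scalerBr scalerA scalerDl.
by rewrite addrAC (addrC (y *: _)); congr (_ - _ *: _); ring.
Qed.

Lemma wcomm_short m l : (l <= n)%N -> wcomm m l.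
Proof.
elim: l => [|l IH] ln x y; first by rewrite /= !mulr1.
rewrite !wprod_mul_qexp //; have := IH (ltnW ln) => E.
by rewrite (E x) (E (Q * x)) (addrC x) (mulrC x).
Qed.

Lemma wcomm_long m l : (n < l.+2)%N -> wcomm m.+1 l -> wcomm m.+1 l.+1 ->
  wcomm m l.+1 -> wcomm m l.+2.
Proof.
move=> nl commM commB commA x y; set a := v m; set b := v (m + l.+1)%N.
pose Mx := wprod m.+1 l.
have EaE z : wprod m l.+1 z = Mx z * (1 + z *: a) by apply: wprod_recl.
have EbE z : wprod m.+1 l.+1 z = (1 + z *: b) * Mx z by rewrite /= /b addnS addSn.
have EE z : wprod m l.+2 z = (1 + z *: b) * Mx z * (1 + z *: a).
  by rewrite [LHS]/= -/(wprod m l.+1 z) EaE mulrA.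
(* Exchanging the two middle factors 1 + x a and 1 + y b of E(x) E(y) gives S,
   which is symmetric in x, y by the hypotheses on the shorter windows; the
   error term T involves [a, b] and is symmetric by q-commutation. *)
pose S z t := (1 + z *: b) * Mx z * (1 + t *: b) * ((1 + z *: a) * Mx t * (1 + t *: a)).
have S_sym z t : S z t = S t z.
  pose Mi := wprod_inv m.+1 l.
  (* Inserting inverses of the common middle window turns S into products over the two windows that
     lack one end. *)
  have SE z' t' : S z' t' = wprod m.+1 l.+1 z' * wprod m.+1 l.+1 t' * (Mi t' * Mi z')
      * (wprod m l.+1 z' * wprod m l.+1 t').
    rewrite /S !EaE !EbE.
    have -> : (1 + t' *: b) = (1 + t' *: b) * Mx t' * Mi t' by rewrite -mulrA wprodK mulr1.
    have -> : (1 + z' *: a) = Mi z' * (Mx z' * (1 + z' *: a)).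
      by rewrite mulrA wprodKV mul1r.
    rewrite -[(1 + t' *: b) * Mx t' * Mi t' * Mx t']mulrA wprodKV mulr1.
    rewrite [Mx z' * (Mi z' * _)]mulrA wprodK mul1r.
    by rewrite !mulrA.
  by rewrite !SE commA commB (wprod_inv_comm _ _ commM).
pose c := a * b - b * a; pose T z t := (z * t) *: (Mx z * c * Mx t).
have c_far : (n < l.+1)%N -> c = 0.
  by move=> nl'; apply/eqP; rewrite subr_eq0 eq_sym; apply/eqP/v_comm; lia.
have bM z : (l < n)%N -> b * Mx z = Mx (Q * z) * b.
  by move=> ln; apply: mul_wprod; lia.
have Ma z : (l < n)%N -> Mx z * a = a * Mx (Q * z).
  by move=> ln; apply: wprod_mul; lia.
(* When the ends are exactly n apart, b passes through [Mx] and meets c, where b a b and b b vanish;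
   farther apart, c itself is 0. *)
have bMc z : b * (Mx z * c) = 0.
  have [nl'|ln] := ltnP n l.+1; first by rewrite c_far // !mulr0.
  have nE : (m + l.+1 = m + n)%N by lia.
  rewrite mulrA bM // -mulrA /c mulrBr !mulrA.
  by rewrite /a /b nE v_down v_sqr mul0r subr0 mulr0.
have cMa z : c * (Mx z * a) = 0.
  have [nl'|ln] := ltnP n l.+1; first by rewrite c_far // !mul0r.
  have nE : (m + l.+1 = m + n)%N by lia.
  rewrite Ma // mulrA /c mulrBl -(mulrA b a a).
  by rewrite /a /b nE v_up v_sqr mulr0 subr0 mul0r.
have ETS z t : wprod m l.+2 z * wprod m l.+2 t = S z t + T z t.
  have cE : (1 + z *: a) * (1 + t *: b) = (1 + t *: b) * (1 + z *: a) + (z * t) *: c.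
    rewrite !mulrDl !mulrDr !mul1r !mulr1 -!scalerAl -!scalerAr !scalerA (mulrC t).
    rewrite /c scalerBr -!addrA; congr (_ + _); rewrite [RHS]addrCA; congr (_ + _).
    by congr (_ + _); rewrite addrCA subrr addr0.
  rewrite !EE /S /T -!mulrA; set w := Mx t * (1 + t *: a).
  rewrite [(1 + z *: a) * ((1 + t *: b) * _)]mulrA cE [(_ * _ + _) * _]mulrDl.
  rewrite [Mx z * (_ + _)]mulrDr [(1 + z *: b) * (_ + _)]mulrDr -!mulrA; congr (_ + _).
  rewrite -!scalerAl -!scalerAr; congr (_ *: _).
  have -> : c * w = c * Mx t.
    by rewrite /w [Mx t * _]mulrDr mulr1 -scalerAr mulrDr -scalerAr cMa scaler0 addr0.
  by rewrite mulrDl mul1r -scalerAl !mulrA -(mulrA b) bMc mul0r scaler0 addr0.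
have T_sym z t : T z t = T t z.
  rewrite /T (mulrC t); congr (_ *: _).
  have [nl'|ln] := ltnP n l.+1; first by rewrite c_far // !(mulr0, mul0r).
  (* Pulling a and b outside rescales both middle products by Q in the term a b and by its inverse
     in the term b a; what stays inside commutes by hypothesis. *)
  have QK w : w = Q * (Q^-1 * w) by rewrite mulVKf.
  have aE z' t' : Mx z' * a * b * Mx t' = a * (Mx (Q * z') * Mx (Q * t')) * b.
    by rewrite Ma // -!mulrA bM.
  have bE z' t' : Mx z' * b * a * Mx t' = b * (Mx (Q^-1 * z') * Mx (Q^-1 * t')) * a.
    by rewrite {1}(QK z') -bM // {1}(QK t') -!mulrA Ma.
  rewrite /c !mulrBr !mulrBl !mulrA aE bE.
  by rewrite (commM (Q * z)) (commM (Q^-1 * z)) -aE -bE.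
by rewrite !ETS S_sym T_sym.
Qed.

Lemma wcommP m l : wcomm m l.
Proof.
elim/ltn_ind: l m => l IH m; have [ln|nl] := leqP l n; first exact: wcomm_short.
by case: l IH nl => [|[|l]] IH nl; [lia|lia|apply: wcomm_long => //; apply: IH].
Qed.

End WindowProduct.

(** * Commutation of the complete homogeneous operators *)

(** Subtracting the relation at x from that at t x removes [c 0] and leaves a multiple of x;
    dividing by x gives a shorter relation in which [c k.+1] is scaled by the nonzero t^(k+1) -
    1. *)
Lemma vandermonde_eq0 (K : fieldType) (V : lmodType K) (t : K) (N : nat)
    (c : nat -> V) :
  t != 0 -> (forall k, t ^+ k.+1 != 1) ->
  (forall x, x != 0 -> \sum_(k < N) x ^+ k *: c k = 0) ->
  forall k, (k < N)%N -> c k = 0.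
Proof.
move=> t_neq0 t_ord; elim: N c => // N IH c c_eq0.
have cS k : (k < N)%N -> c k.+1 = 0.
  move=> kN; suff /eqP : (t ^+ k.+1 - 1) *: c k.+1 = 0.
    by rewrite scaler_eq0 subr_eq0 (negbTE (t_ord k)) => /eqP.
  apply: (IH (fun k => (t ^+ k.+1 - 1) *: c k.+1)) => // x x0.
  apply: (scalerI x0); rewrite scaler0.
  have tx0 : t * x != 0 by rewrite mulf_neq0.
  have := c_eq0 _ tx0; rewrite -[RHS](c_eq0 _ x0) !big_ord_recl /= !expr0.
  move=> /addrI/eqP; rewrite -subr_eq0 -sumrB => /eqP sum0.
  rewrite -[RHS]sum0 scaler_sumr; apply: eq_bigr => i _.
  rewrite /bump /= add1n !scalerA -scalerBl; congr (_ *: _).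
  by rewrite exprMn !exprS; ring.
case=> [_|k kN]; last exact: cS.
have := c_eq0 1 (oner_neq0 K); rewrite big_ord_recl expr0 scale1r big1 ?addr0 // => i _.
by rewrite lift0 cS ?scaler0 ?ltn_ord.
Qed.

Section WindowSum.
Variables (K : fieldType) (A : algType K) (w : nat -> A).

Fixpoint wcoef l k : A :=
  match l, k with
  | _, 0%N => 1
  | 0%N, _.+1 => 0
  | l'.+1, k'.+1 => wcoef l' k'.+1 + w l' * wcoef l' k'
  end.

Lemma wcoef0 l : wcoef l 0 = 1. Proof. by case: l. Qed.

Lemma wcoef_eq0 l k : (l < k)%N -> wcoef l k = 0.
Proof.
elim: l k => [|l IH] [|k] //= lk.
by rewrite !IH ?mulr0 ?addr0 // ltnW.
Qed.

Lemma wprod_wcoef l N x : (l <= N)%N ->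
  wprod w 0 l x = \sum_(k < N.+1) x ^+ k *: wcoef l k.
Proof.
elim: l => [|l IH] lN.
  by rewrite big_ord_recl expr0 scale1r big1 ?addr0 // => i _; rewrite scaler0.
rewrite /= add0n IH ?(ltnW lN) // mulrDl mul1r [in RHS]big_ord_recl /= expr0 scale1r.
rewrite [X in X + _]big_ord_recl expr0 wcoef0 scale1r -addrA; congr (_ + _).
rewrite [X in _ + _ * X]big_ord_recr /= wcoef_eq0 // scaler0 addr0.
rewrite mulr_sumr -big_split /=; apply: eq_bigr => i _.
rewrite /bump /= add1n scalerDr; congr (_ + _).
by rewrite -scalerAl -scalerAr scalerA -exprS.
Qed.

Lemma wcoef_comm (t : K) l j k : t != 0 -> (forall k, t ^+ k.+1 != 1) ->
  wcomm w 0 l -> wcoef l j * wcoef l k = wcoef l k * wcoef l j.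
Proof.
move=> t0 t_ord lcomm.
have coefE y : wcoef l j * wprod w 0 l y = wprod w 0 l y * wcoef l j.
  apply/eqP; rewrite -subr_eq0; apply/eqP.
  pose c i := wcoef l i * wprod w 0 l y - wprod w 0 l y * wcoef l i.
  (* The length l + j + 1 covers the whole product and also the index j, which may exceed l. *)
  apply: (@vandermonde_eq0 _ _ t (l + j).+1 c) => // [x _|]; last by lia.
  under eq_bigr do rewrite scalerBr scalerAl scalerAr.
  rewrite sumrB -mulr_suml -mulr_sumr -wprod_wcoef ?leq_addr //.
  by rewrite lcomm subrr.
apply/eqP; rewrite -subr_eq0; apply/eqP.
pose c i := wcoef l j * wcoef l i - wcoef l i * wcoef l j.
apply: (@vandermonde_eq0 _ _ t (l + k).+1 c) => // [x _|]; last by lia.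
under eq_bigr do rewrite scalerBr scalerAr scalerAl.
rewrite sumrB -mulr_suml -mulr_sumr -wprod_wcoef ?leq_addr //.
by rewrite coefE subrr.
Qed.

End WindowSum.

(** Splits on whether the largest admissible value is used, in the same pattern as [wcoef]. *)
Fixpoint increasing_in (a : int) (l k : nat) : seq (k.-tuple int) :=
  match l, k with
  | _, 0%N => [:: [tuple]]
  | 0%N, _.+1 => [::]
  | l'.+1, k'.+1 => increasing_in a l' k'.+1
      ++ map (fun s : k'.-tuple int => [tuple of rcons s (a + l'%:Z)])
           (increasing_in a l' k')
  end.

Lemma mem_increasing_in a l k (s : k.-tuple int) :
  (s \in increasing_in a l k)
  = sorted <%R s && all (fun i => a <= i < a + l%:Z) s.
Proof.
elim: l k s => [|l IH] [|k] s; rewrite ?tuple0 //=.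
  by rewrite in_nil; case: (tupleP s) => i t /=; rewrite andbA andbC; lia.
rewrite mem_cat IH; apply/orP/andP.
  case=> [/andP [-> /allP sP]|/mapP [t]].
    by split=> //; apply/allP => i /sP; lia.
  rewrite IH !(sorted_pairwise lt_trans) => /andP [t_sorted /allP tP] ->.
  rewrite /= pairwise_rcons t_sorted all_rcons andbT; split.
    by apply/allP => i /tP; lia.
  by apply/andP; split; [lia|apply/allP => i /tP; lia].
case: s => s; case/lastP: s => [|s x] // size_s; have /eqP := size_s.
rewrite size_rcons => -[] /eqP size_s' /=.
rewrite !(sorted_pairwise lt_trans) pairwise_rcons all_rcons.
move=> [/andP [/allP sx s_pw]] /andP [xP /allP sP].
have [xl|xl] := eqVneq x (a + l%:Z); last first.
  left; rewrite all_rcons s_pw; apply/andP; split.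
    by rewrite andbT; apply/allP.
  by apply/andP; split; [lia|apply/allP => i si; have := sx _ si; have := sP _ si; lia].
right; apply/mapP; exists (Tuple size_s'); last by apply/val_inj; rewrite /= xl.
rewrite IH (sorted_pairwise lt_trans) s_pw.
by apply/allP => i si; have := sx _ si; have := sP _ si; lia.
Qed.

Lemma uniq_increasing_in a l k : uniq (increasing_in a l k).
Proof.
elim: l k => [|l IH] [|k] //=; rewrite cat_uniq IH /=.
rewrite map_inj_uniq ?IH ?andbT => [|s t /(congr1 val) /= /rcons_inj [st]]; last first.
  exact: val_inj.
apply/hasPn => _ /mapP [s _ ->]; rewrite mem_increasing_in /= all_rcons.
lia.
Qed.

(** * Reduction to finitely many ribbon operators *)

Section LocalFinite.
Variables (K : fieldType) (q : K) (n : nat).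
Implicit Types (la : intpart) (v : fock K) (a : int).

(* The restriction of h_op q n k to the operators u_i with a <= i < a + l. *)
Definition h_win a l k : fock_end K :=
  wcoef (fun i => ribbon_op q n (a + i%:Z)) l k.

Lemma ribbon_word_rcons (s : seq int) i :
  ribbon_word q n (rcons s i) = ribbon_op q n i * ribbon_word q n s.
Proof. by rewrite /ribbon_word rev_rcons big_cons. Qed.

Lemma h_winE a l k :
  h_win a l k = \sum_(s <- increasing_in a l k) ribbon_word q n s.
Proof.
rewrite /h_win; elim: l k => [|l IH] [|k] /=.
- by rewrite big_seq1 /ribbon_word big_nil.
- by rewrite big_nil.
- by rewrite big_seq1 /ribbon_word big_nil.
rewrite big_cat big_map /= !IH mulr_sumr; congr (_ + _).
by apply: eq_bigr => s _; rewrite ribbon_word_rcons.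
Qed.

Lemma fock_end_sum (I : Type) (r : seq I) (F : I -> fock_end K) v :
  (\sum_(i <- r) F i : fock_end K) v = \sum_(i <- r) F i v.
Proof. by elim: r => [|i r IH]; rewrite ?big_nil // !big_cons -IH. Qed.

Lemma h_op_local_basis k la a l :
  a <= - (#|` diagram la|%fset + n * k)%N%:Z ->
  (#|` diagram la|%fset + n * k)%N%:Z < a + l%:Z ->
  h_op q n k << la >> = h_win a l k << la >>.
Proof.
move=> aB Bl; rewrite h_winE fock_end_sum.
rewrite [LHS](lin_extU (fun la => \sum_(s \in @increasing k) ribbon_word q n s << la >>)).
rewrite (fsbigE (increasing_in a l k)) ?uniq_increasing_in //.
- rewrite big_seq_cond [RHS]big_seq; apply: eq_bigl => s.
  have [|//] := boolP (s \in increasing_in a l k).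
  by rewrite mem_increasing_in => /andP [s_sorted _] /=; apply/mem_set.
- by move=> s /=; rewrite mem_increasing_in => /andP [].
move=> s s_sorted; rewrite mem_increasing_in s_sorted /=.
move=> /allPn [i si ia]; apply/eqP; apply: contraNT ia.
move=> /ribbon_word_bound /(_ i si); rewrite size_tuple; lia.
Qed.

(** Holds for every large enough window, so that several vectors can share one in [h_op_comm]. *)
Lemma h_op_local k v : exists B : nat, forall a l,
  a <= - B%:Z -> B%:Z < a + l%:Z -> h_op q n k v = h_win a l k v.
Proof.
pose size_la la := (#|` diagram la|%fset + n * k)%N.
exists (\max_(la <- dom v) size_la la) => a l aB Bl.
rewrite -(freeg_sumE v) !linear_sum big_seq [RHS]big_seq; apply: eq_bigr => la la_v.
have -> : << coeff la v *g la >> = coeff la v *: (<< la >> : fock K).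
  by apply/eqP/freeg_eqP => mu; rewrite coeffZ !coeffU mul1r.
rewrite !linearZ /=; congr (_ *: _).
have : (size_la la <= \max_(la <- dom v) size_la la)%N.
  by apply: leq_bigmax_seq.
by move=> leB; apply: h_op_local_basis; rewrite -/(size_la la); lia.
Qed.

Hypothesis n_gt0 : (0 < n)%N.
Hypothesis q_neq0 : q != 0.
Hypothesis q_ord : forall k, q ^+ k.+1 != 1.

Lemma h_win_comm a l j k : h_win a l j * h_win a l k = h_win a l k * h_win a l j.
Proof.
apply: (@wcoef_comm _ _ _ q) => //.
apply: (@wcommP _ _ (q ^+ 2) _ n); rewrite ?expf_neq0 //.
- by move=> i i' ii'; apply: ribbon_op_qcomm => //; lia.
- by move=> i i' ii'; apply: ribbon_op_comm => //; lia.
- by move=> i; apply: ribbon_op_sqr.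
- move=> i; have -> : a + (i + n)%N%:Z = a + i%:Z + n%:Z by lia.
  exact: ribbon_op_braid_up.
- move=> i; have -> : a + (i + n)%N%:Z = a + i%:Z + n%:Z by lia.
  exact: ribbon_op_braid_down.
Qed.

Lemma h_op_comm j k : h_op q n j * h_op q n k = h_op q n k * h_op q n j.
Proof.
apply/fock_endP => v.
rewrite -[LHS]/(h_op q n j (h_op q n k v)) -[RHS]/(h_op q n k (h_op q n j v)).
have [B1 B1P] := h_op_local j v; have [B2 B2P] := h_op_local k v.
have [B3 B3P] := h_op_local j (h_op q n k v).
have [B4 B4P] := h_op_local k (h_op q n j v).
pose B := (B1 + B2 + B3 + B4)%N; pose a : int := - B%:Z; pose l := (B + B).+1.
rewrite (B3P a l) ?(B4P a l) ?(B2P a l) ?(B1P a l); try by rewrite /a /l /B; lia.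
exact: (congr1 (fun f : fock_end K => f v) (h_win_comm a l j k)).
Qed.

End LocalFinite.

(** * The ring of symmetric functions *)

Section AlgEval.
Variables (K : fieldType) (A : algType K) (m : nat) (h : 'I_m -> A).
Implicit Types (P Q : {mpoly K[m]}).

(** [A] may be noncommutative: linearity is unconditional, while multiplicativity is proved for
    commuting values. *)
Definition alg_eval P : A := mmap (in_alg A) h P.

Lemma alg_evalE P : alg_eval P = \sum_(x <- msupp P) P@_x *: mmap1 h x.
Proof. by apply: eq_bigr => x _; rewrite mulr_algl. Qed.

Lemma alg_eval_is_zmod_morphism : zmod_morphism alg_eval.
Proof. exact: mmap_is_additive. Qed.

HB.instance Definition _ :=
  GRing.isZmodMorphism.Build {mpoly K[m]} A alg_eval alg_eval_is_zmod_morphism.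

Lemma alg_eval_is_scalable : scalable alg_eval.
Proof. by move=> a P; rewrite /alg_eval mmapZ mulr_algl. Qed.

HB.instance Definition _ :=
  GRing.isScalable.Build K {mpoly K[m]} A *:%R alg_eval alg_eval_is_scalable.

Lemma alg_evalXm x : alg_eval 'X_[x] = mmap1 h x. Proof. exact: mmapX. Qed.

Lemma alg_evalX i : alg_eval 'X_i = h i. Proof. by rewrite alg_evalXm mmap1U. Qed.

Lemma alg_evalC a : alg_eval a%:MP = a%:A. Proof. exact: mmapC. Qed.

Lemma alg_evalM P Q : (forall i j, h i * h j = h j * h i) ->
  alg_eval (P * Q) = alg_eval P * alg_eval Q.
Proof.
move=> h_comm; have XM x y : mmap1 h (x + y)%MM = mmap1 h x * mmap1 h y.
  rewrite /mmap1 -prodrM_comm => [|i j _ _]; last first.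
    by apply/commrX/commr_sym/commrX/h_comm.
  by apply: eq_bigr => i _; rewrite mnmDE exprD.
rewrite [in LHS](mpolyE P) [in LHS](mpolyE Q) [alg_eval P]alg_evalE [alg_eval Q]alg_evalE.
rewrite mulr_suml [in RHS]mulr_suml raddf_sum; apply: eq_bigr => x _ /=.
rewrite !mulr_sumr raddf_sum; apply: eq_bigr => y _ /=.
rewrite -scalerAl -scalerAr -mpolyXD !linearZ /= alg_evalXm XM.
by rewrite -[RHS]scalerAl -[in RHS]scalerAr.
Qed.

End AlgEval.

Lemma alg_eval_morph (K : fieldType) (A B : algType K) (f : A -> B) m
    (h : 'I_m -> A) P :
  {morph f : x y / x + y} -> {morph f : x y / x * y} -> scalable f ->
  f 0 = 0 -> f 1 = 1 ->
  f (alg_eval h P) = alg_eval (f \o h) P.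
Proof.
move=> fD fM fZ f0 f1; rewrite !alg_evalE (big_morph f fD f0).
apply: eq_bigr => x _; rewrite fZ /mmap1 (big_morph f fM f1); congr (_ *: _).
apply: eq_bigr => i _ /=; elim: (x i) => [|k IH]; first by rewrite !expr0.
by rewrite !exprS fM IH.
Qed.

Lemma eq_alg_eval (K : fieldType) (A : algType K) m (h h' : 'I_m -> A) P :
  h =1 h' -> alg_eval h P = alg_eval h' P.
Proof. by move=> hh; rewrite !alg_evalE; apply: eq_bigr => x _; rewrite (mmap1_eq _ hh). Qed.

Lemma alg_eval_id (K : fieldType) m (P : {mpoly K[m]}) :
  alg_eval (fun i => 'X_i) P = P.
Proof.
by rewrite alg_evalE [RHS]mpolyE; apply: eq_bigr => x _; rewrite mmap1_id.
Qed.

Lemma alg_eval_comp (K : fieldType) m k (t : m.-tuple {mpoly K[k]}) P :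
  P \mPo t = alg_eval (tnth t) P.
Proof. by rewrite comp_mpolyE alg_evalE. Qed.

(** * Duality of elementary and complete symmetric functions *)

Section DualSequence.
Variable A : comNzRingType.
Implicit Types y p : nat -> A.

(* The relation between the elementary and complete symmetric functions. *)
Definition dual_upto N y p : Prop :=
  [/\ y 0%N = 1, p 0%N = 1 & forall k, (k < N)%N ->
      \sum_(i < k.+2) (-1) ^+ i * (y i * p (k.+1 - i)%N) = 0].

Lemma dual_upto_sym N y p : dual_upto N y p -> dual_upto N p y.
Proof.
move=> [y0 p0 yp]; split=> // k kN; rewrite (reindex_inj rev_ord_inj) /=.
transitivity ((-1) ^+ k.+1 * \sum_(i < k.+2) (-1) ^+ i * (y i * p (k.+1 - i)%N)).
  rewrite mulr_sumr; apply: eq_bigr => i _.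
  rewrite subSS; have ik : (i <= k.+1)%N by rewrite -ltnS.
  rewrite subKn // mulrA -exprD; congr (_ * _); last by rewrite mulrC.
  rewrite -signr_odd oddB // -[in RHS]signr_odd oddD.
  by case: (odd k.+1); case: (odd i).
by rewrite yp // mulr0.
Qed.

Lemma dual_upto_uniq N y p p' : dual_upto N y p -> dual_upto N y p' ->
  forall k, (k <= N)%N -> p k = p' k.
Proof.
move=> [y0 p0 yp] [_ p'0 yp']; elim/ltn_ind => -[|k] IH kN; first by rewrite p0 p'0.
have := etrans (yp k kN) (esym (yp' k kN)).
rewrite ![\sum_(i < k.+2) _]big_ord_recl /= !expr0 !mul1r y0 !mul1r subn0.
set S := (X in p k.+1 + X = _); set S' := (X in _ = p' k.+1 + X).
suff -> : S = S' by move/addIr.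
rewrite /S /S'; apply: eq_bigr => i _; rewrite /bump /= add1n subSS IH //; lia.
Qed.

(** Course-of-values recursion: entry i of the list is the value at k - i. *)
Fixpoint dual_rec y k : seq A :=
  if k is k'.+1 then
    (\sum_(i < k) (-1) ^+ i * (y i.+1 * (dual_rec y k')`_i)) :: dual_rec y k'
  else [:: 1].

Definition dual_seq y k : A := (dual_rec y k)`_0.

Lemma nth_dual_rec y k i : (i <= k)%N -> (dual_rec y k)`_i = dual_seq y (k - i).
Proof. by elim: k i => [|k IH] [|i] // ik; rewrite /= IH. Qed.

Lemma dual_seqS y k :
  dual_seq y k.+1 = \sum_(i < k.+1) (-1) ^+ i * (y i.+1 * dual_seq y (k - i)).
Proof. by apply: eq_bigr => i _; rewrite nth_dual_rec // -ltnS. Qed.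

Lemma dual_seqP N y : y 0%N = 1 -> dual_upto N y (dual_seq y).
Proof.
move=> y0; split=> // k _; rewrite big_ord_recl /= expr0 !mul1r y0 mul1r subn0.
rewrite dual_seqS -big_split /= big1 // => i _.
by rewrite /bump /= add1n subSS exprS mulN1r mulNr subrr.
Qed.

Lemma eq_dual_upto N y y' p p' :
  (forall k, (k <= N)%N -> y k = y' k) -> (forall k, (k <= N)%N -> p k = p' k) ->
  dual_upto N y p -> dual_upto N y' p'.
Proof.
move=> yy pp [y0 p0 yp]; split; rewrite -?yy -?pp // => k kN.
rewrite -[RHS](yp k kN); apply: eq_bigr => i _.
by have := ltn_ord i => ik; rewrite yy ?pp //; lia.
Qed.

End DualSequence.

Lemma dual_upto_morph (A B : comNzRingType) (f : A -> B) N y p :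
  {morph f : x y / x + y} -> {morph f : x y / x * y} -> f 0 = 0 -> f 1 = 1 ->
  dual_upto N y p -> dual_upto N (f \o y) (f \o p).
Proof.
move=> fD fM f0 f1 [y0 p0 yp]; split; rewrite /= ?y0 ?p0 // => k kN.
have fN x : f (- x) = - f x by apply/eqP; rewrite -addr_eq0 -fD addNr f0.
rewrite -[RHS]f0 -[in RHS](yp k kN) (big_morph f fD f0); apply: eq_bigr => i _.
by rewrite /= -[in LHS]signr_odd -[in RHS]signr_odd !mulr_sign; case: (odd i); rewrite ?fN fM.
Qed.

Section ElementaryComplete.
Variable K : fieldType.

Lemma mcoeff_mulX m (p : {mpoly K[m]}) (a x : 'X_{1..m}) :
  (p * 'X_[a])@_x = if (a <= x)%MM then p@_(x - a) else 0.
Proof.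
case: ifP => [ax|ax]; first by rewrite -{1}(submK ax) addmC mcoeffMX.
rewrite mcoeffM big1 // => k /eqP xE; rewrite mcoeffX; case: eqP => [aE|_]; last first.
  by rewrite mulr0.
by rewrite xE aE lem_addl in ax.
Qed.

(** The sum expands the product of the [F i + 1], whose factor at any i with x_i > 0 vanishes. *)
Lemma sum_sign_subsets m (x : 'X_{1..m}) : (0 < mdeg x)%N ->
  \sum_(S : {set 'I_m} | (mesym1 S <= x)%MM) (-1) ^+ #|S| = 0 :> K.
Proof.
move=> x0; have [j xj] : exists j, (0 < x j)%N.
  apply/existsP; rewrite -[X in is_true X]negbK; apply/negP => /existsPn x_0.
  by move: x0; rewrite mdegE big1 // => i _; have := x_0 i; lia.
pose F i : K := - (0 < x i)%:R.
rewrite -[RHS](_ : \prod_i (F i + 1) = 0); last first.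
  by rewrite (bigD1 j) //= /F xj addNr mul0r.
rewrite bigA_distr big_mkcond /=; apply: eq_bigr => S _.
case: ifP => [/mnm_lepP Sx|/negP Sx].
  rewrite -big_mkcond /= -[LHS]prodr_const; apply: eq_bigr => i iS.
  by have := Sx i; rewrite mnmE iS /F => ->.
have [i /andP [iS xi]] : exists i, (i \in S) && (x i == 0%N).
  apply/existsP; rewrite -[X in is_true X]negbK; apply/negP => /existsPn SxP.
  by apply: Sx; apply/mnm_lepP => i; rewrite mnmE; have := SxP i; case: (i \in S); lia.
by rewrite (bigD1 i) //= iS /F (eqP xi) oppr0 mul0r.
Qed.

Lemma mesym_dual_complete_hom N m :
  dual_upto N (mesym m K) (fun k => complete_hom K k m).
Proof.
split; first exact: mesym0E.
  apply/mpolyP => x; rewrite mcoeff_complete_hom mcoeff1 mdeg_eq0; congr (_%:R).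
have mcoeff_sign i (p : {mpoly K[m]}) x : ((-1) ^+ i * p)@_x = (-1) ^+ i * p@_x.
  rewrite -[in LHS]signr_odd -[in RHS]signr_odd !mulr_sign.
  by case: (odd i); rewrite ?mcoeffN.
move=> k _; apply/mpolyP => x; rewrite mcoeff0 raddf_sum /=.
transitivity (\sum_(S : {set 'I_m} | (mesym1 S <= x)%MM)
    if mdeg x == k.+1 then (-1) ^+ #|S| else 0 : K); last first.
  have [xk|xk] := eqVneq (mdeg x) k.+1; last by rewrite big1.
  by rewrite sum_sign_subsets // xk.
transitivity (\sum_(i < k.+2) \sum_(S : {set 'I_m})
    if #|S| == i then (-1) ^+ i * (if (mesym1 S <= x)%MM
      then (mdeg (x - mesym1 S)%MM == k.+1 - i)%N%:R else 0) else 0 : K).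
  apply: eq_bigr => i _; rewrite -big_mkcond /= mesymE mulr_suml mulr_sumr raddf_sum /=.
  apply: eq_bigr => S _.
  by rewrite mcoeff_sign (mulrC 'X_[_]) mcoeff_mulX mcoeff_complete_hom.
rewrite exchange_big /= [RHS]big_mkcond; apply: eq_bigr => S _.
case: ifP => [Sx|_]; last by rewrite big1 // => i _; case: ifP; rewrite ?mulr0.
have degS : (#|S| <= mdeg x)%N by rewrite -mdeg_mesym1 -(submK Sx) mdegD leq_addl.
have degB : mdeg (x - mesym1 S)%MM = (mdeg x - #|S|)%N.
  by rewrite -{2}(submK Sx) mdegD mdeg_mesym1 addnK.
have [Sk|kS] := ltnP #|S| k.+2; last first.
  rewrite big1 => [|i _]; first by case: eqP => // xE; lia.
  by case: eqP => // Si; move: kS; rewrite Si leqNgt ltn_ord.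
rewrite (bigD1 (Ordinal Sk)) //= eqxx big1 => [|i /negP iS]; last first.
  by case: eqP => // Si; case: iS; apply/eqP/val_inj.
rewrite addr0 degB; case: (mdeg x =P k.+1) => [->|xk]; first by rewrite eqxx mulr1.
case: eqP => [/= E|_]; last by rewrite mulr0.
by case: xk; rewrite -(subnK degS) E subnK.
Qed.

End ElementaryComplete.

Section SymmetricFunctions.
Variable K : fieldType.
Implicit Types f g : symfun K.

Lemma in_varsD m f g : in_vars (f + g) m = in_vars f m + in_vars g m. Proof. by []. Qed.
Lemma in_varsM m f g : in_vars (f * g) m = in_vars f m * in_vars g m. Proof. by []. Qed.
Lemma in_varsZ m (a : K) f : in_vars (a *: f) m = a *: in_vars f m. Proof. by []. Qed.
Lemma in_vars0 m : in_vars (0 : symfun K) m = 0. Proof. by []. Qed.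
Lemma in_vars1 m : in_vars (1 : symfun K) m = 1. Proof. by []. Qed.

Lemma in_vars_alg_eval m d (h : 'I_d -> symfun K) P :
  in_vars (alg_eval h P) m = P \mPo [tuple in_vars (h i) m | i < d].
Proof.
rewrite (@alg_eval_morph _ _ _ (fun f => in_vars f m)) // alg_eval_comp.
by apply: eq_alg_eval => i; rewrite tnth_mktuple.
Qed.

(** The elementary symmetric functions, built from the [hsym] so that they visibly lie in the
    algebra these generate. *)
Definition esym_seq := dual_seq (hsym K).

Lemma hsym0 : hsym K 0 = 1.
Proof.
apply/symfunP => m; apply/mpolyP => x.
by rewrite /= mcoeff_complete_hom mcoeff1 mdeg_eq0.
Qed.

Lemma in_vars_esym m k : in_vars (esym_seq k) m = mesym m K k.
Proof.
have H1 : dual_upto k (fun k => in_vars (hsym K k) m) (fun k => in_vars (esym_seq k) m).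
  apply: (@dual_upto_morph _ _ (fun f : symfun K => in_vars f m)) => //.
  by apply: dual_seqP; exact: hsym0.
have H2 : dual_upto k (fun k => in_vars (hsym K k) m) (mesym m K).
  exact/dual_upto_sym/mesym_dual_complete_hom.
exact: (dual_upto_uniq H1 H2 (leqnn k)).
Qed.

Lemma hsym_alg_independent : alg_independent (fun i : nat => hsym K i.+1).
Proof.
(* The substitution sending the k-th variable to p k is an involution, and it
   sends the elementary to the complete symmetric polynomials; this reduces the
   claim to the algebraic independence of the former. *)
move=> d P P0; have {P0} : P \mPo [tuple complete_hom K i.+1 d | i < d] = 0.
  by rewrite -(in_vars_alg_eval d (fun i : 'I_d => hsym K i.+1)) /alg_eval P0.
(* The sequence 1, then the d variables shifted by one index, then zeros. *)
pose X k : {mpoly K[d]} :=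
  if k is k'.+1 then oapp (fun j : 'I_d => 'X_j) 0 (insub k') else 1.
pose p := dual_seq X; have Xp : dual_upto d X p by apply: dual_seqP.
have X_comp (a : nat -> {mpoly K[d]}) k : a 0%N = 1 -> (k <= d)%N ->
    X k \mPo [tuple a i.+1 | i < d] = a k.
  case: k => [|k] a0 kd; first by rewrite rmorph1 a0.
  by rewrite /X insubT /= comp_mpolyXU (nth_map (Sub k kd)) ?size_enum_ord // nth_enum_ord.
have comp_dual (a : nat -> {mpoly K[d]}) : a 0%N = 1 ->
    dual_upto d a (fun k => p k \mPo [tuple a i.+1 | i < d]).
  move=> a0; pose c := comp_mpoly [tuple a i.+1 | i < d].
  have : dual_upto d (c \o X) (c \o p).
    apply: dual_upto_morph Xp; rewrite /c.
    - exact: rmorphD.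
    - exact: rmorphM.
    - exact: rmorph0.
    - exact: rmorph1.
  by apply: eq_dual_upto => // k kd; apply: X_comp.
have compA (a b : nat -> {mpoly K[d]}) :
    (forall k, (k <= d)%N -> p k \mPo [tuple b i.+1 | i < d] = a k) ->
    P \mPo [tuple a i.+1 | i < d]
    = (P \mPo [tuple p i.+1 | i < d]) \mPo [tuple b i.+1 | i < d].
  move=> ab; rewrite !(alg_eval_comp _ P) (alg_eval_morph (f := comp_mpoly [tuple b i.+1 | i < d])).
  - by apply: eq_alg_eval => i; rewrite /= !tnth_mktuple ab.
  - exact: rmorphD.
  - exact: rmorphM.
  - by move=> c x; rewrite linearZ.
  - exact: rmorph0.
  - exact: rmorph1.
rewrite (compA (fun k => complete_hom K k d) (mesym d K)); last first.
  have D1 := comp_dual (mesym d K) (mesym0E d K).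
  have D2 : dual_upto d (mesym d K) (fun k => complete_hom K k d).
    exact: mesym_dual_complete_hom.
  by move=> k kd; apply: (dual_upto_uniq D1 D2 kd).
move=> /msym_fundamental_un0 P0.
have p0 : p 0%N = 1 by [].
have := compA X p; rewrite P0 rmorph0 => PX.
rewrite -[LHS](alg_eval_id P) -[RHS]PX.
  rewrite alg_eval_comp; apply: eq_alg_eval => i.
  by rewrite tnth_mktuple /X valK.
by move=> k kd; apply: (dual_upto_uniq (comp_dual p p0) (dual_upto_sym Xp) kd).
Qed.

Lemma symfun_eq0 d f : (forall m x, (d <= mdeg x)%N -> (in_vars f m)@_x = 0) ->
  in_vars f d = 0 -> f = 0.
Proof.
move=> f_deg fd; have [f_sym f_drop _] : compatible (in_vars f) by case: (f).
apply/symfunP => m; rewrite in_vars0.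
have [/subnKC <-|/ltnW/subnKC] := leqP d m.
  elim: (m - d)%N => [|k IH]; first by rewrite addn0.
  rewrite addnS; apply/mpolyP => x; rewrite mcoeff0.
  have [dx|xd] := leqP d (mdeg x); first exact: f_deg.
  (* A monomial of degree < d in more than d variables misses one of them. *)
  have [i xi] : exists i, x i == 0%N.
    apply/existsP; rewrite -[X in is_true X]negbK; apply/negP => /existsPn x_gt0.
    move: xd; rewrite ltnNge mdegE => /negP; apply.
    rewrite (@leq_trans (\sum_(i < (d + k).+1) 1)) //.
      by rewrite sum1_card card_ord; lia.
    by apply: leq_sum => i _; rewrite lt0n x_gt0.
  rewrite -(msym_coeff _ (tperm i ord_max) (f_sym _)).
  set x' := [multinom _ | _ < _].
  have -> : x' = mnm_ext0 [multinom x' (widen_ord (leqnSn _) j) | j < d + k].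
    apply/mnmP => j; rewrite [RHS]mnmE; case: unliftP => [j' ->|->] /=.
      by rewrite mnmE widen_lift_max.
    by rewrite mnmE tpermR (eqP xi).
  by rewrite -mcoeff_drop_last_var f_drop IH mcoeff0.
move: (d - m)%N fd => k + dE; rewrite -dE; elim: k {dE} => [|k IH]; first by rewrite addn0.
by rewrite addnS => fS; apply: IH; rewrite -f_drop fS raddf0.
Qed.

(** The fundamental theorem is applied in d variables only, d bounding the degrees of f; its weight
    bound on P lets [symfun_eq0] extend the identity to all numbers of variables. *)
Lemma symfun_esym f : exists d (P : {mpoly K[d]}),
  f = alg_eval (fun i : 'I_d => esym_seq i.+1) P.
Proof.
have [f_sym _ [d f_deg]] : compatible (in_vars f) by case: (f).
have [P [PE P_wgt]] := sym_fundamental (f_sym d).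
exists d, P; apply/eqP; rewrite -subr_eq0; apply/eqP.
apply: (@symfun_eq0 d); last first.
  rewrite in_varsD -[- _]scaleN1r in_varsZ scaleN1r in_vars_alg_eval -[X in X - _]PE.
  apply/eqP; rewrite subr_eq0; apply/eqP; congr (_ \mPo _).
  by apply: eq_from_tnth => i; rewrite !tnth_mktuple in_vars_esym.
move=> m x dx; rewrite in_varsD -[- _]scaleN1r in_varsZ mcoeffD mcoeffZ.
have -> : (in_vars f m)@_x = 0.
  by apply/memN_msupp_eq0/mmeasure_mnm_ge/(leq_trans (f_deg m)).
rewrite add0r.
rewrite in_vars_alg_eval comp_mpolyE raddf_sum big_seq big1 ?mulr0 //= => y yP.
have y_wgt : (mnmwgt y < d)%N.
  by apply: leq_trans (leq_trans P_wgt (f_deg d)); apply: mmeasure_mnm_lt yP.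
rewrite mcoeffZ; set prod := (X in X@_x).
suff prod_homog : prod \is (mnmwgt y).-homog.
  by rewrite (dhomog_nemf_coeff prod_homog) ?mulr0 //=; lia.
rewrite /prod /mnmwgt; apply: (big_ind2 (fun p k => p \is k.-homog)).
- exact: dhomog1.
- by move=> p k p' k'; apply: dhomogM.
- move=> i _; rewrite mulnC; apply: dhomogMn; rewrite tnth_mktuple in_vars_esym.
  exact: dhomog_mesym.
Qed.

End SymmetricFunctions.

(** * Partitions with rows far apart *)

Section RowMoves.
Variables (n : nat) (la mu : intpart).

(** The second conclusion says that all added boxes lie in row r, which gives spin 0. *)
Lemma raises_row r : (forall s, s != r -> nth 0%N mu s = nth 0%N la s) ->
  nth 0%N mu r = (nth 0%N la r + n)%N ->
  raises n ((nth 0%N la r)%:Z - r%:Z + n%:Z - 1) la mu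
  /\ forall c, (nth 0%N la r)%:Z - r%:Z <= c < (nth 0%N la r)%:Z - r%:Z + n%:Z ->
       level la c = r.
Proof.
move=> row_s row_r.
have lv_r c : (nth 0%N la r)%:Z - r%:Z <= c < (nth 0%N la r)%:Z - r%:Z + n%:Z ->
    level la c = r /\ level mu c = r.+1.
  move=> cP; have := ltn_level la c r; have := ltn_level mu c r; rewrite row_r.
  have [s_eq|s_neq] := eqVneq (level la c) r; last first.
    have := ltn_level la c (level la c); have := ltn_level mu c (level la c).
    by rewrite row_s //; lia.
  have := ltn_level la c r.+1; have := ltn_level mu c r.+1.
  by rewrite row_s; lia.
split=> [c|c /lv_r []//].
have [cP|cP] := boolP ((nth 0%N la r)%:Z - r%:Z <= c < (nth 0%N la r)%:Z - r%:Z + n%:Z).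
  by have [-> ->] := lv_r c cP; lia.
have lvE s : (s < level mu c)%N = (s < level la c)%N.
  rewrite !ltn_level; have [->|sr] := eqVneq s r; last by rewrite row_s.
  by rewrite row_r; lia.
by have := lvE (level mu c); have := lvE (level la c); lia.
Qed.

Lemma leq_row_level r : (forall c, (level la c <= level mu c)%N) ->
  (nth 0%N la r <= nth 0%N mu r)%N.
Proof.
move=> lv_le; have := ltn_level mu ((nth 0%N mu r)%:Z - r%:Z) r.
have := ltn_level la ((nth 0%N mu r)%:Z - r%:Z) r.
have := lv_le ((nth 0%N mu r)%:Z - r%:Z); lia.
Qed.

End RowMoves.

Section SpreadPartitions.
Variables (K : fieldType) (q : K) (n : nat).
Variables (m D : nat).
Implicit Types (al be : 'X_{1..m}) (r s : 'I_m) (v : fock K) (i : int).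

(** A row grows by at most n * D boxes, so it stays at least n boxes shorter than the row above. The
    truncation at D in [spread_row] makes the rows weakly decreasing for every exponent. *)
Definition gap := (n * D + n)%N.

Definition spread_row be (k : nat) : nat :=
  if insub k is Some r then ((m - k) * gap + n * minn (be r) D)%N else 0%N.

Lemma spread_row_ord be r : spread_row be r = ((m - r) * gap + n * minn (be r) D)%N.
Proof. by rewrite /spread_row valK. Qed.

Lemma spread_row_out be k : (m <= k)%N -> spread_row be k = 0%N.
Proof. by move=> mk; rewrite /spread_row insubF // ltnNge mk. Qed.

Lemma spread_row_dec be k : (spread_row be k.+1 <= spread_row be k)%N.
Proof.
have [km|mk] := ltnP k.+1 m; last by rewrite spread_row_out.
have := spread_row_ord be (Ordinal km); have := spread_row_ord be (Ordinal (ltnW km)).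
move=> /= -> ->; rewrite (_ : (m - k = (m - k.+1).+1)%N); last by lia.
have minP t : (n * minn t D <= n * D)%N by rewrite leq_mul2l geq_minr orbT.
rewrite mulSn; move: (_ * gap)%N => x; rewrite /gap.
have := minP (be (Ordinal km)); lia.
Qed.

(* The partition with m rows that are far apart, row r being extended by be r
   (at most D) horizontal n-ribbons. *)
Definition spread be : intpart :=
  projT1 (cid (intpart_of (spread_row_dec be) (spread_row_out be (leqnn m)))).

Lemma nth_spread be k : nth 0%N (spread be) k = spread_row be k.
Proof. exact: projT2 (cid (intpart_of _ _)) k. Qed.

Lemma size_spread be : (size (spread be) <= m)%N.
Proof. by rewrite -parts_neq0 nth_spread spread_row_out. Qed.

Hypothesis n_gt0 : (0 < n)%N.

(* The operator whose action moves the bead of row r to its place in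
   spread be. *)
Definition last_move be r : int := (spread_row be r)%:Z - (r : nat)%:Z - 1.

Lemma last_move_inj be r s : last_move be r = last_move be s -> r = s.
Proof.
rewrite /last_move => E; apply: val_inj => /=; move: E; rewrite -!nth_spread.
have [rs|sr] := leqP r s; first by have := leq_parts (spread be) rs; lia.
by have := leq_parts (spread be) (ltnW sr); lia.
Qed.

Lemma leq_coord_mdeg be r : (be r <= mdeg be)%N.
Proof. by rewrite mdegE (bigD1 r) //= leq_addr. Qed.

Lemma spread_raises be r : (mdeg be <= D)%N -> (0 < be r)%N ->
  raises n (last_move be r) (spread (be - U_(r))) (spread be)
  /\ bead_spin n (last_move be r) (spread (be - U_(r))) = 0%N.
Proof.
move=> beD be_r; have be_le s : (be s <= D)%N := leq_trans (leq_coord_mdeg be s) beD.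
have row_r : nth 0%N (spread be) r = (nth 0%N (spread (be - U_(r))) r + n)%N.
  rewrite !nth_spread !spread_row_ord -addnA; congr (_ + _)%N.
  rewrite mnmBE mnm1E eqxx (minn_idPl _) ?be_le //.
  rewrite (minn_idPl _); last by have := be_le r; lia.
  by rewrite -mulnSr; congr (_ * _)%N; lia.
have row_s (k : nat) : k != r :> nat -> nth 0%N (spread be) k = nth 0%N (spread (be - U_(r))) k.
  move=> kr; rewrite !nth_spread; have [km|mk] := ltnP k m; last first.
    by rewrite !spread_row_out.
  have := spread_row_ord be (Ordinal km).
  have := spread_row_ord (be - U_(r)) (Ordinal km) => /= -> ->.
  rewrite mnmBE mnm1E; case: eqP => [rE|_]; last by rewrite subn0.
  by case/negP: kr; rewrite rE.
have [raise_r lv_r] := raises_row row_s row_r.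
have moveE : last_move be r
    = (nth 0%N (spread (be - U_(r))) r)%:Z - (r : nat)%:Z + n%:Z - 1.
  by rewrite /last_move -nth_spread row_r; lia.
rewrite moveE; split=> //; rewrite /bead_spin !lv_r ?subnn //; lia.
Qed.

Lemma raises_spread i la be : raises n i la (spread be) ->
  exists2 r, last_move be r = i & (nth 0%N la r < spread_row be r)%N.
Proof.
move=> la_be; set mu := spread be in la_be.
have lv1 := la_be (i + 1); have lv2 := la_be i.
have lv3 := la_be (i - n%:Z); have lv4 := la_be (i - n%:Z + 1).
have st1 := level_step la i; have st2 := level_step mu i.
have st3 := level_step la (i - n%:Z); have st4 := level_step mu (i - n%:Z).
have row1 := ltn_level mu i (level mu (i + 1)).
have row2 := ltn_level mu (i + 1) (level mu (i + 1)).
have row3 := ltn_level la i (level mu (i + 1)).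
(* The bead that lands at i + 1 belongs to row [level mu (i + 1)]. Were that row empty, all
   positions to its left would be filled, yet the move vacates i - n + 1. *)
have lt_m : (level mu (i + 1) < m)%N.
  rewrite ltnNge; apply/negP => m_le; have := size_spread be; rewrite -/mu => sz.
  have row0 : nth 0%N mu (level mu (i + 1)) = 0%N.
    by apply/eqP; rewrite parts_neq0; apply: leq_trans m_le.
  have low1 := @level_low mu (i - n%:Z); have low2 := @level_low mu (i - n%:Z + 1).
  by lia.
exists (Ordinal lt_m); rewrite /last_move -?nth_spread -/mu /=; lia.
Qed.

(** Excludes the predecessors of [spread be] in which an unextended row would be shorter than its
    initial length. Adding ribbons preserves it. *)
Definition above v : Prop :=
  forall nu, coeff nu v != 0 -> forall r, ((m - r) * gap <= nth 0%N nu r)%N.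

Lemma above_ribbon_op i v : above v -> above (ribbon_op q n i v).
Proof.
move=> v_above nu nu_v r.
have [[la la_nu]|no_la] := pselect (exists la, raises n i la nu); last first.
  by move: nu_v; rewrite coeff_ribbon_op0 ?eqxx // => la la_nu; case: no_la; exists la.
move: nu_v; rewrite (coeff_ribbon_op _ n_gt0 _ la_nu) mulf_eq0 negb_or => /andP [_ /v_above].
move=> /(_ r) /leq_trans; apply; apply: leq_row_level => c.
by rewrite la_nu leq_addr.
Qed.

Lemma aboveD v w : above v -> above w -> above (v + w).
Proof.
move=> v_above w_above nu; rewrite coeffD.
have [-> |/v_above //] := eqVneq (coeff nu v) 0; rewrite add0r; exact: w_above.
Qed.

Lemma aboveZ a v : above v -> above (a *: v).
Proof. by move=> v_above nu; rewrite coeffZ mulf_eq0 negb_or => /andP [_ /v_above]. Qed.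

Lemma above0 : above 0. Proof. by move=> nu; rewrite coeff0 eqxx. Qed.

Lemma above_spread0 : above << spread 0%MM >>.
Proof.
move=> nu; rewrite coeffU mul1r; case: (spread 0%MM =P nu) => [<- _ r|_]; last by rewrite eqxx.
by rewrite nth_spread spread_row_ord leq_addr.
Qed.

Lemma above_h_win a l k v : above v -> above (h_win q n a l k v).
Proof.
rewrite /h_win => v_above; elim: l k => [|l IH] [|k] //=; first exact: above0.
apply: aboveD; first exact: IH.
exact/above_ribbon_op/IH.
Qed.

Lemma coeff_spread_ribbon_op i v be : (mdeg be <= D)%N -> above v ->
  coeff (spread be) (ribbon_op q n i v)
  = \sum_(r | (0 < be r)%N && (last_move be r == i)) coeff (spread (be - U_(r))) v.
Proof.
move=> beD v_above.
have [[r /andP [be_r /eqP ri]]|no_r] :=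
    pselect (exists r, (0 < be r)%N && (last_move be r == i)).
  rewrite (bigD1 r) /=; last by rewrite be_r ri eqxx.
  rewrite big1 ?addr0 => [|s /andP [/andP [_ /eqP si]] /eqP sr].
    have [raise_r spin_r] := spread_raises beD be_r; rewrite ri in raise_r spin_r.
    by rewrite (coeff_ribbon_op _ n_gt0 _ raise_r) spin_r mul1r.
  by case: sr; apply: (@last_move_inj be); rewrite si.
rewrite big_pred0 => [|r]; last by apply/negP => rP; case: no_r; exists r.
have [[la la_be]|no_la] := pselect (exists la, raises n i la (spread be)); last first.
  by rewrite coeff_ribbon_op0 // => la la_be; case: no_la; exists la.
rewrite (coeff_ribbon_op _ n_gt0 _ la_be).
have [r ri lt_row] := raises_spread la_be.
have be_r : be r = 0%N.
  apply/eqP; rewrite -leqn0 leqNgt; apply/negP => be_r; case: no_r.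
  by exists r; rewrite be_r ri eqxx.
have [->|/v_above /(_ r)] := eqVneq (coeff la v) 0; first by rewrite mulr0.
by move: lt_row; rewrite spread_row_ord be_r; lia.
Qed.

(** The last move in a row has the largest index used there, so it alone is compared with the upper
    end of the window. *)
Definition reachable a l k al be : bool :=
  [&& (al <= be)%MM, mdeg be == (mdeg al + k)%N &
      [forall r, (al r < be r)%N ==> (last_move be r < a + l%:Z)]].

Lemma last_moveB be r : (mdeg be <= D)%N -> (0 < be r)%N ->
  last_move (be - U_(r)) r = last_move be r - n%:Z.
Proof.
move=> beD be_r; have be_le : (be r <= D)%N := leq_trans (leq_coord_mdeg be r) beD.
rewrite /last_move !spread_row_ord mnmBE mnm1E eqxx.
rewrite !(minn_idPl _) ?be_le //; last by lia.
have : (n * be r = n * (be r - 1) + n)%N.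
  by rewrite -mulnSr; congr (_ * _)%N; lia.
by lia.
Qed.

Lemma last_moveB_neq be r s : s != r ->
  last_move (be - U_(r)) s = last_move be s.
Proof.
by move=> sr; rewrite /last_move !spread_row_ord mnmBE mnm1E eq_sym (negbTE sr) subn0.
Qed.

(** Passing from [al] to [be] fixes a set of moves with distinct indices, so exactly one increasing
    word performs it, with coefficient 1. The bound on a puts every such index inside the lower end
    of the window. *)
Lemma coeff_spread_h_win a (l k w : nat) v be : a < - m%:Z ->
  (mdeg be <= D)%N -> (mdeg be < w)%N -> above v ->
  coeff (spread be) (h_win q n a l k v)
  = \sum_(al : 'X_{1..m < w} | reachable a l k al be) coeff (spread al) v.
Proof.
move=> am + + v_above.
have bounded al be' : mdeg al = mdeg be' -> (al <= be')%MM -> al = be'.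
  move=> deg_eq le_al; rewrite -(submK le_al) -[LHS]add0m; congr (_ + _)%MM.
  by apply/esym/eqP; rewrite -mdeg_eq0 -(eqn_add2r (mdeg al)) -mdegD submK // deg_eq.
have case0 l' be' : (mdeg be' < w)%N ->
    coeff (spread be') v
    = \sum_(al : 'X_{1..m < w} | reachable a l' 0 al be') coeff (spread al) v.
  move=> bew; rewrite (bigD1 (BMultinom bew)) /=; last first.
    by rewrite /reachable lepm_refl addn0 eqxx; apply/forallP => r; rewrite ltnn.
  rewrite big1 ?addr0 // => al /andP [/and3P [le_al /eqP deg_al _]] /eqP al_be.
  by case: al_be; apply/val_inj/bounded; rewrite // deg_al addn0.
elim: l k be => [|l IH] [|k] be beD bew; rewrite /h_win /=.
- exact: case0.
- rewrite coeff0 big1 // => al /and3P [le_al /eqP deg_al /forallP alP].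
  have [r lt_r] : exists r, (al r < be r)%N.
    apply/existsP; rewrite -[X in is_true X]negbK; apply/negP => /existsPn ge_al.
    have : (mdeg be <= mdeg al)%N.
      by rewrite !mdegE; apply: leq_sum => r _; rewrite leqNgt ge_al.
    lia.
  have := alP r; rewrite lt_r /last_move; have := ltn_ord r; lia.
- exact: case0.
rewrite -/(h_win q n a l k.+1) -/(h_win q n a l k) coeffD IH //.
rewrite coeff_spread_ribbon_op //; last exact: above_h_win.
have reach_eq : (forall r, (0 < be r)%N -> last_move be r != a + l%:Z) ->
    forall al, reachable a l.+1 k.+1 al be = reachable a l k.+1 al be.
  move=> no_r al; rewrite /reachable; congr [&& _, _ & _]; apply: eq_forallb => r.
  by case: ltnP => //= al_r; have := no_r r (leq_ltn_trans (leq0n _) al_r); lia.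
have [[r /andP [be_r /eqP r_move]]|no_r] :=
    pselect (exists r, (0 < be r)%N && (last_move be r == a + l%:Z)); last first.
  rewrite [X in _ + X]big_pred0 ?addr0 => [|r]; last by apply/negP => rP; case: no_r; exists r.
  apply: eq_bigl => al; apply/esym/reach_eq => r be_r; apply/negP => rP.
  by case: no_r; exists r; rewrite be_r.
rewrite [X in _ + X](bigD1 r) /=; last by rewrite be_r r_move eqxx.
rewrite [X in _ + (_ + X)]big1 ?addr0; last first.
  move=> s /andP [/andP [_ /eqP s_move]] /eqP sr; case: sr.
  by apply: (@last_move_inj be); rewrite s_move.
have degB : (mdeg (be - U_(r))%MM).+1 = mdeg be.
  have /submK {2}<- : (U_(r) <= be)%MM by rewrite lep1mP; lia.
  by rewrite mdegD mdeg1 addn1.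
rewrite IH; [|lia|lia].
rewrite [RHS](bigID (fun al : 'X_{1..m < w} => al r == be r)) /=; congr (_ + _).
  apply: eq_bigl => al; apply/and3P/andP.
    move=> [le_al deg_al /forallP alP]; have al_r : al r = be r.
      apply/eqP; rewrite eqn_leq (mnm_lepP le_al) leqNgt; apply/negP => lt_r.
      by have := alP r; rewrite lt_r r_move ltxx.
    split; last by rewrite al_r.
    apply/and3P; split=> //; apply/forallP => s; apply/implyP => lt_s.
    by have := alP s; rewrite lt_s /=; lia.
  move=> [/and3P [le_al deg_al /forallP alP] /eqP al_r]; split=> //.
  apply/forallP => s; apply/implyP => lt_s; have := alP s; rewrite lt_s /= => lt_move.
  have s_move : last_move be s <> a + l%:Z.
    move=> s_move; have sr : s = r by apply: (@last_move_inj be); rewrite s_move.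
    by rewrite sr al_r ltnn in lt_s.
  by lia.
apply: eq_bigl => al; apply/and3P/andP.
  move=> [/mnm_lepP le_al /eqP deg_al /forallP alP].
  have lt_r : (al r < be r)%N by have := le_al r; rewrite mnmBE mnm1E eqxx; lia.
  split; last by rewrite neq_ltn lt_r.
  apply/and3P; split.
  - by apply/mnm_lepP => s; have := le_al s; rewrite mnmBE; lia.
  - by rewrite -degB deg_al addnS.
  apply/forallP => s; apply/implyP => lt_s.
  have [->|sr] := eqVneq s r; first by rewrite r_move; lia.
  have := alP s; rewrite last_moveB_neq // mnmBE mnm1E eq_sym (negbTE sr) subn0 lt_s /=.
  by lia.
move=> [/and3P [/mnm_lepP le_al /eqP deg_al /forallP alP] al_r].
have lt_r : (al r < be r)%N by rewrite ltn_neqAle al_r le_al.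
split.
- apply/mnm_lepP => s; rewrite mnmBE mnm1E; have := le_al s.
  by case: eqP => [<-|_]; lia.
- by apply/eqP; move: degB; rewrite deg_al; lia.
apply/forallP => s; apply/implyP.
have [->|sr] := eqVneq s r; first by rewrite last_moveB // r_move; lia.
rewrite last_moveB_neq // mnmBE mnm1E eq_sym (negbTE sr) subn0 => lt_s.
have := alP s; rewrite lt_s /= => lt_move.
have s_move : last_move be s <> a + l%:Z.
  by move=> s_move; case/eqP: sr; apply: (@last_move_inj be); rewrite s_move.
by lia.
Qed.

Lemma mcoeff_complete_hom_mul k (p : {mpoly K[m]}) be :
  (complete_hom K k m * p)@_be
  = \sum_(al : 'X_{1..m < (mdeg be).+1} | (al <= be)%MM && (mdeg be == mdeg al + k)%N) p@_al.
Proof.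
have subP al : (mdeg (be - al)%MM < (mdeg be).+1)%N.
  by rewrite ltnS !mdegE; apply: leq_sum => r _; rewrite mnmBE leq_subr.
pose h (al : 'X_{1..m < (mdeg be).+1}) := (BMultinom (subP al), al).
rewrite mcoeffM (reindex_onto h snd) /=; last first.
  move=> [x y] /= /eqP beE; congr (_, _); apply/val_inj => /=.
  by have := congr1 (fun z => (z - y)%MM) beE; rewrite addmK.
rewrite big_mkcond [RHS]big_mkcond; apply: eq_bigr => al _ /=.
rewrite eqxx andbT mcoeff_complete_hom.
have [le_al|le_al] := boolP (al <= be)%MM.
  have degE : mdeg be = (mdeg (be - al)%MM + mdeg al)%N by rewrite -mdegD submK.
  rewrite submK // eqxx /=.
  have <- : (mdeg (be - al)%MM == k) = (mdeg be == mdeg al + k)%N by lia.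
  by case: eqP; rewrite ?mul1r ?mul0r.
case: eqP => // beE; case/negP: le_al; apply/mnm_lepP => r.
by have := congr1 (fun z : 'X_{1..m} => z r) beE; rewrite mnmDE; lia.
Qed.

Lemma coeff_spread_h_op k v (p : {mpoly K[m]}) : above v ->
  (forall al, (mdeg al <= D)%N -> coeff (spread al) v = p@_al) ->
  above (h_op q n k v) /\ forall be, (mdeg be <= D)%N ->
    coeff (spread be) (h_op q n k v) = (complete_hom K k m * p)@_be.
Proof.
move=> v_above vp; have [B BP] := h_op_local q n k v.
(* B serves locality, m the bound on a, and m * gap + n * D exceeds every last move, so the window
   condition in [reachable] becomes vacuous. *)
pose C := (B + m + m * gap + n * D + 1)%N; pose a : int := - C%:Z; pose l := (C + C)%N.
have hE : h_op q n k v = h_win q n a l k v by apply: BP; rewrite /a /l /C; lia.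
rewrite hE; split=> [|be beD]; first exact: above_h_win.
rewrite (@coeff_spread_h_win _ _ _ (mdeg be).+1) //; last by rewrite /a /C; lia.
rewrite mcoeff_complete_hom_mul; apply: eq_big => [al|al _]; last first.
  by apply: vp; apply: leq_trans beD; rewrite -ltnS bmdeg.
rewrite /reachable; congr (_ && _); rewrite andb_idr // => _.
apply/forallP => r; apply/implyP => _.
rewrite /last_move spread_row_ord.
have : (n * minn (be r) D <= n * D)%N by rewrite leq_mul2l geq_minr orbT.
have : ((m - r) * gap <= m * gap)%N by rewrite leq_mul2r leq_subr orbT.
move: ((m - r) * gap)%N (n * minn _ _)%N => x y.
by rewrite /a /l /C; move: (m * gap)%N (n * D)%N => z t; lia.
Qed.

End SpreadPartitions.

(** * The action of symmetric functions *)

Section SymfunAction.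
Variables (K : fieldType) (q : K) (n : nat).
Implicit Types (f g : symfun K) (A B : fock_end K).

(* The graph of the homomorphism sending hsym k to h_op q n k; defining it as
   a relation avoids choosing polynomial expressions in the hsym k. *)
Inductive h_graph : symfun K -> fock_end K -> Prop :=
| h_graphC (a : K) : h_graph a%:A a%:A
| h_graphH k : h_graph (hsym K k.+1) (h_op q n k.+1)
| h_graphD f g A B : h_graph f A -> h_graph g B -> h_graph (f + g) (A + B)
| h_graphM f g A B : h_graph f A -> h_graph g B -> h_graph (f * g) (A * B).

Lemma h_graph0 : h_graph 0 0.
Proof. by have := h_graphC 0; rewrite !scale0r. Qed.

Lemma h_graph1 : h_graph 1 1.
Proof. by have := h_graphC 1; rewrite !scale1r. Qed.

Lemma h_graphZ a f A : h_graph f A -> h_graph (a *: f) (a *: A).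
Proof. by move=> fA; have := h_graphM (h_graphC a) fA; rewrite !mulr_algl. Qed.

Lemma h_graphB f g A B : h_graph f A -> h_graph g B -> h_graph (f - g) (A - B).
Proof. by move=> fA gB; rewrite -!scaleN1r; apply/h_graphD/h_graphZ. Qed.

Lemma h_graphX f A k : h_graph f A -> h_graph (f ^+ k) (A ^+ k).
Proof.
move=> fA; elim: k => [|k IH]; first by rewrite !expr0; exact: h_graph1.
by rewrite !exprS; apply: h_graphM.
Qed.

Lemma h_graph_alg_eval m (s : 'I_m -> symfun K) (S : 'I_m -> fock_end K) P :
  (forall i, h_graph (s i) (S i)) -> h_graph (alg_eval s P) (alg_eval S P).
Proof.
move=> sS; rewrite !alg_evalE.
apply: (big_ind2 h_graph) => [|f A g B fA gB|x _]; first exact: h_graph0.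
  exact: h_graphD.
apply: h_graphZ; apply: (big_ind2 h_graph) => [|f A g B fA gB|i _].
- exact: h_graph1.
- exact: h_graphM.
- exact: h_graphX.
Qed.

Lemma h_graph_total f : exists A, h_graph f A.
Proof.
have [d [P ->]] := symfun_esym f.
have esymP k : exists A, h_graph (esym_seq K k) A.
  elim/ltn_ind: k => -[|k] IH; first by exists 1; exact: h_graph1.
  rewrite /esym_seq dual_seqS.
  apply: (big_ind (fun f => exists A, h_graph f A)); first by exists 0; exact: h_graph0.
    by move=> ? ? [A ?] [B ?]; exists (A + B); apply: h_graphD.
  move=> i _; have [|A iA] := IH (k - i)%N; first by lia.
  exists ((-1) ^+ i * (h_op q n i.+1 * A)); apply: h_graphM; last first.
    by apply: h_graphM => //; apply: h_graphH.
  by apply: h_graphX; have := h_graphC (-1); rewrite !scaleN1r.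
exists (alg_eval (fun i : 'I_d => projT1 (cid (esymP i.+1))) P).
by apply: h_graph_alg_eval => i; exact: projT2 (cid (esymP i.+1)).
Qed.

Hypothesis n_gt0 : (0 < n)%N.

(** Coefficients of degree at most D in a product involve only such coefficients of the factors, so
    the truncation survives composition; [above] is returned so that operators can be chained. *)
Lemma h_graph_spread f A : h_graph f A -> forall m D (v : fock K) (p : {mpoly K[m]}),
  above n m D v ->
  (forall al : 'X_{1..m}, (mdeg al <= D)%N -> coeff (spread n D al) v = p@_al) ->
  above n m D (A v) /\ forall be : 'X_{1..m}, (mdeg be <= D)%N ->
    coeff (spread n D be) (A v) = (in_vars f m * p)@_be.
Proof.
move=> fA m D; elim: fA => [a|k|{}f g {}A B _ IH1 _ IH2|{}f g {}A B _ IH1 _ IH2] v p v_ab vp.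
- have -> : (a%:A : fock_end K) v = a *: v by [].
  split=> [|be beD]; first exact: aboveZ.
  by rewrite in_varsZ in_vars1 mulr_algl coeffZ mcoeffZ vp.
- exact: coeff_spread_h_op.
- have [Av_ab Av] := IH1 v p v_ab vp; have [Bv_ab Bv] := IH2 v p v_ab vp.
  have -> : (A + B) v = A v + B v by [].
  split=> [|be beD]; first exact: aboveD.
  by rewrite in_varsD mulrDl coeffD mcoeffD Av ?Bv.
have [Bv_ab Bv] := IH2 v p v_ab vp; have [ABv_ab ABv] := IH1 (B v) _ Bv_ab Bv.
by split=> // be beD; rewrite in_varsM -mulrA; apply: ABv.
Qed.

Lemma h_graph_inj f : h_graph f 0 -> f = 0.
Proof.
move=> f0; apply/symfunP => m; rewrite in_vars0; apply/mpolyP => be; rewrite mcoeff0.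
(* D is tailored to the coefficient under test, and v plays the part of the polynomial 1. *)
pose D := mdeg be; pose v : fock K := << spread n D (0%MM : 'X_{1..m}) >>.
have v1 (al : 'X_{1..m}) : (mdeg al <= D)%N -> coeff (spread n D al) v = (1 : {mpoly K[m]})@_al.
  move=> alD; rewrite coeffU mcoeff1 mul1r; congr (nat_of_bool _)%:R.
  apply/eqP/eqP => [sE|->] //; apply/mnmP => r; rewrite mnm0E.
  have := congr1 (fun la : intpart => nth 0%N la r) sE.
  rewrite /= !nth_spread !spread_row_ord mnm0E min0n muln0 addn0 => /esym/eqP.
  rewrite -[X in _ == X]addn0 eqn_add2l muln_eq0 => /orP [/eqP n0|]; first by lia.
  by have := leq_coord_mdeg al r; lia.
have v_ab : above n m D v by exact: above_spread0.
have [_ /(_ be (leqnn _))] := h_graph_spread f0 v_ab v1.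
by rewrite mulr1 => <-; exact: coeff0.
Qed.

Lemma h_op_alg_independent : alg_independent (fun i : nat => h_op q n i.+1).
Proof.
move=> m P P0; apply: (@hsym_alg_independent K); apply: h_graph_inj.
rewrite -P0; apply: h_graph_alg_eval => i; exact: h_graphH.
Qed.

Hypothesis q_neq0 : q != 0.
Hypothesis q_ord : forall k, q ^+ k.+1 != 1.

(** All large d are allowed so that two polynomials can be taken in the same variables. The product
    case rests on the commutation of the [h_op]. *)
Lemma h_graph_polyP f A : h_graph f A -> exists d0, forall d, (d0 <= d)%N ->
  exists P : {mpoly K[d]}, f = alg_eval (fun i : 'I_d => hsym K i.+1) P
    /\ A = alg_eval (fun i : 'I_d => h_op q n i.+1) P.
Proof.
elim=> [a|k|{}f g {}A B _ [d1 IH1] _ [d2 IH2]|{}f g {}A B _ [d1 IH1] _ [d2 IH2]].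
- by exists 0%N => d _; exists a%:MP; rewrite !alg_evalC.
- by exists k.+1 => d kd; exists 'X_(Ordinal kd); rewrite !alg_evalX.
- exists (maxn d1 d2) => d; rewrite geq_max => /andP [/IH1 [P [-> ->]] /IH2 [Q [-> ->]]].
  by exists (P + Q); rewrite !raddfD.
exists (maxn d1 d2) => d; rewrite geq_max => /andP [/IH1 [P [-> ->]] /IH2 [Q [-> ->]]].
exists (P * Q); split; rewrite alg_evalM // => i j; first exact: mulrC.
exact: h_op_comm.
Qed.

Lemma h_graph_fun f A B : h_graph f A -> h_graph f B -> A = B.
Proof.
move=> fA fB; have := h_graphB fA fB; rewrite subrr => /h_graph_polyP [d /(_ d (leqnn d))].
move=> [P [/esym P0 /eqP]]; rewrite (hsym_alg_independent P0) raddf0 subr_eq0.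
by move/eqP.
Qed.

Definition h_action f : fock_end K := projT1 (cid (h_graph_total f)).

Lemma h_actionP f : h_graph f (h_action f).
Proof. exact: projT2 (cid (h_graph_total f)). Qed.

Lemma h_action_eq f A : h_graph f A -> h_action f = A.
Proof. exact/h_graph_fun/h_actionP. Qed.

Lemma h_action_is_zmod_morphism : zmod_morphism h_action.
Proof. by move=> f g; apply/h_action_eq/h_graphB; exact: h_actionP. Qed.

Lemma h_action_is_monoid_morphism : monoid_morphism h_action.
Proof.
split; first exact/h_action_eq/h_graph1.
by move=> f g; apply/h_action_eq/h_graphM; exact: h_actionP.
Qed.

Lemma h_action_is_scalable : scalable h_action.
Proof. by move=> a f; apply/h_action_eq/h_graphZ/h_actionP. Qed.

HB.instance Definition _ :=
  GRing.isZmodMorphism.Build (symfun K) (fock_end K) h_action h_action_is_zmod_morphism.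
HB.instance Definition _ :=
  GRing.isMonoidMorphism.Build (symfun K) (fock_end K) h_action h_action_is_monoid_morphism.
HB.instance Definition _ :=
  GRing.isScalable.Build K (symfun K) (fock_end K) *:%R h_action h_action_is_scalable.

Lemma h_action_exists : exists Phi : {lrmorphism symfun K -> fock_end K},
  [/\ forall k : nat, (0 < k)%N -> Phi (hsym K k) = h_op q n k,
      injective Phi &
      range Phi = generated_subalgebra
        [set h_op q n k | k in [set k | (0 < k)%N]]]%classic.
Proof.
exists (h_action : {lrmorphism symfun K -> fock_end K}); split.
- by case=> // k _; apply/h_action_eq/h_graphH.
- move=> f g fg; apply/eqP; rewrite -subr_eq0; apply/eqP/h_graph_inj.
  have := h_graphB (h_actionP f) (h_actionP g).
  by have -> : h_action f = h_action g := fg; rewrite subrr.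
apply/seteqP; split=> [_ [f _ <-] B B_alg SB|A A_gen].
  have [B1 Blin BM] := B_alg; rewrite -[X in X \in B]/(h_action f).
  move: (h_action f) (h_actionP f) => A fA.
  elim: fA => {f A} [a|k|f g A A' _ fA _ gA'|f g A A' _ fA _ gA'].
  - have B0 : 0 \in B by have := Blin (-1) _ _ B1 B1; rewrite scaleN1r addNr.
    by have := Blin a _ _ B1 B0; rewrite addr0.
  - by apply: SB; exists k.+1.
  - by have := Blin 1 _ _ fA gA'; rewrite scale1r.
  - exact: BM.
pose B : {pred fock_end K} := [pred A | `[< exists f, h_graph f A >]].
have BE A' : (A' \in B) <-> exists f, h_graph f A' by split=> [/asboolP|/asboolP].
have /BE [f fA] : A \in B.
  apply: A_gen => [|_ [[|k] // _ <-]]; last by apply/BE; exists (hsym K k.+1); apply: h_graphH.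
  split.
  - by apply/BE; exists 1; apply: h_graph1.
  - move=> a A1 A2 /BE [f1 fA1] /BE [f2 fA2]; apply/BE; exists (a *: f1 + f2).
    exact/h_graphD/fA2/h_graphZ.
  - move=> A1 A2 /BE [f1 fA1] /BE [f2 fA2]; apply/BE; exists (f1 * f2).
    exact: h_graphM.
by exists f => //; apply: h_action_eq.
Qed.

End SymfunAction.

Lemma qvar_neq0 (R : realType) : qvar R != 0.
Proof. by rewrite /qvar tofrac_eq0 polyX_eq0. Qed.

Lemma qvar_exp_neq1 (R : realType) k : qvar R ^+ k.+1 != 1.
Proof.
rewrite /qvar -tofracXn -tofrac1 tofrac_eq; apply/negP => /eqP.
move=> /(congr1 (fun p : {poly _} => size p)).
by rewrite size_polyXn size_poly1.
Qed.

Local Open Scope classical_set_scope.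

Theorem theorem4p1 (R : realType) (n : nat) (hn : (0 < n)%N) :
  [/\ forall k l : nat, (0 < k)%N -> (0 < l)%N ->
        h_op (qvar R) n k * h_op (qvar R) n l
        = h_op (qvar R) n l * h_op (qvar R) n k,
      alg_independent (fun i : nat => h_op (qvar R) n i.+1) &
      exists Phi : {lrmorphism symfun (Cq R) -> fock_end (Cq R)},
        [/\ forall k : nat, (0 < k)%N ->
              Phi (hsym (Cq R) k) = h_op (qvar R) n k,
            injective Phi &
            range Phi = generated_subalgebra
                          [set h_op (qvar R) n k | k in [set k | (0 < k)%N]]]].
Proof.
split.
- by move=> k l _ _; apply: (h_op_comm hn (qvar_neq0 R) (@qvar_exp_neq1 R)).
- exact: (h_op_alg_independent hn).
- exact: (h_action_exists hn (qvar_neq0 R) (@qvar_exp_neq1 R)).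
Qed.
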